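(* Let $f_0,f_1,f_2$ be real analytic vector fields on $\mathbb{R}^n$ with $f_0(0)=0$, $f_2(0)=0$ and $f_1(0)\neq 0$, and consider the control system $$\dot z = f_0(z)+u_1 f_1(z)+u_2 f_2(z),\qquad z\in\mathbb{R}^n,\ (u_1,u_2)\in\mathbb{R}^2 .$$ Let $R_1(0)\subset\mathbb{R}^n$ be the span of the values at $0$ of all iterated Lie brackets of $f_0,f_1,f_2$ containing $f_1$ at most one time, and let $B_1=[f_1,[f_0,f_1]]$. Assume $B_1(0)\notin R_1(0)$. 1. If $B_1(0)\in R_1(0)+\mathrm{Span}([f_1,[f_2,f_1]](0))$, let $\beta\in\mathbb{R}$ be such that $B_1(0)+\beta\,[f_1,[f_2,f_1]](0)\in R_1(0)$. Then, for any $u_2^{\mathrm{eq}}\in\mathbb{R}$ such that $u_2^{\mathrm{eq}}\neq\beta$, the system is not STLC at $(0,(0,u_2^{\mathrm{eq}}))$. 2. If $B_1(0)\notin R_1(0)+\mathrm{Span}([f_1,[f_2,f_1]](0))$, then, for any $u_2^{\mathrm{eq}}\in\mathbb{R}$ and any $\alpha\geqslant 0$, the system is not $\alpha$-STLC at $(0,(0,u_2^{\mathrm{eq}}))$.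
   Context: Lie brackets: viewing vector fields as first-order differential operators, $[f,g]=fg-gf$. Iterated Lie brackets of $f_0,f_1,f_2$ include the vector fields $f_0,f_1,f_2$ themselves. $\mathbb{R}^2$ (the control space) is endowed with an arbitrary fixed norm $|\cdot|$, and the $\mathrm{L}^\infty$ norm of an $\mathbb{R}^2$-valued control is taken with respect to it. $B(z,\eta)$ is the open Euclidean ball in $\mathbb{R}^n$ centered at $z$ with radius $\eta>0$. Note that, since $f_0(0)=f_2(0)=0$, every $(0,(0,u_2^{\mathrm{eq}}))$ is an equilibrium, i.e. the right-hand side of the system vanishes there. Definition ($\alpha$-STLC). Let $\alpha\geqslant 0$ and let $(z^{\mathrm{eq}},u^{\mathrm{eq}})\in\mathbb{R}^n\times\mathbb{R}^2$ be an equilibrium. The system is $\alpha$-STLC at $(z^{\mathrm{eq}},u^{\mathrm{eq}})$ if, for every $\varepsilon>0$, there exists $\eta>0$ such that, for every $z_0,z_1\in B(z^{\mathrm{eq}},\eta)$, there exists a control $u(\cdot)=(u_1(\cdot),u_2(\cdot))\in \mathrm{L}^\infty([0,\varepsilon],\mathbb{R}^2)$ such that the solution $z(\cdot):[0,\varepsilon]\to\mathbb{R}^n$ of the system with this control satisfies $z(0)=z_0$, $z(\varepsilon)=z_1$, and $\|u-u^{\mathrm{eq}}\|_{\mathrm{L}^\infty([0,\varepsilon],\mathbb{R}^2)}\leqslant \alpha+\varepsilon$. Definition (STLC, small-time local controllability). The system is STLC at $(z^{\mathrm{eq}},u^{\mathrm{eq}})$ if the same property holds with the bound $\|u-u^{\mathrm{eq}}\|_{\mathrm{L}^\infty([0,\varepsilon],\mathbb{R}^2)}\leqslant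 \varepsilon$, i.e. if it is $0$-STLC. *)

(* Defs.v *)
From mathcomp Require Import all_boot all_order all_algebra.
From mathcomp Require Import all_classical all_reals all_analysis.
From mathcomp Require summability.

Set Implicit Arguments.
Unset Strict Implicit.
Unset Printing Implicit Defensive.

Import Order.TTheory GRing.Theory Num.Theory.
Import numFieldNormedType.Exports.

Local Open Scope classical_set_scope.
Local Open Scope ring_scope.

Section vector_fields.
Context {R : realType} {n : nat}.
Local Notation Rn := 'rV[R]_n.

(* Near each point c, g is the sum of a power series in the multi-indices
   k : {ffun 'I_n -> nat}. The sum is unconditional, i.e. along the directed
   set of finite sets of multi-indices. *)
Definition real_analytic (g : Rn -> R) : Prop :=
  forall c : Rn, exists a : {ffun 'I_n -> nat} -> R,
    \forall x \near c,
      summability.partial_sum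
        (fun k : {ffun 'I_n -> nat} =>
           a k * \prod_(i < n) ((x : Rn) 0 i - c 0 i) ^+ k i) A
      @[A --> summability.totally] --> g x.

Definition real_analytic_field (f : Rn -> Rn) : Prop :=
  forall i : 'I_n, real_analytic (fun x => f x 0 i).

(* The i-th component of a vector field is its action, as a first-order
   operator, on the i-th coordinate function; fg - gf thus has i-th component
   f(g_i) - g(f_i), i.e. [f, g] = Dg.f - Df.g. *)
Definition lie_bracket (f g : Rn -> Rn) : Rn -> Rn :=
  fun x => 'D_(f x) g x - 'D_(g x) f x.

Section iterated.
Variables f0 f1 f2 : Rn -> Rn.

(* [iterated_bracket k g]: g is the value of a formal iterated bracket of
   f0, f1, f2 (an arbitrary bracketing) in which f1 occurs exactly k times. *)
Inductive iterated_bracket : nat -> (Rn -> Rn) -> Prop :=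
| iterated_f0 : iterated_bracket 0 f0
| iterated_f1 : iterated_bracket 1 f1
| iterated_f2 : iterated_bracket 0 f2
| iterated_lie p q g h :
    iterated_bracket p g -> iterated_bracket q h ->
    iterated_bracket (p + q) (lie_bracket g h).

End iterated.

Definition lin_span (S : set Rn) : set Rn :=
  [set v | exists2 s : seq Rn, (forall x, x \in s -> S x) & v \in << s >>%VS].

Definition R1_at0 (f0 f1 f2 : Rn -> Rn) : set Rn :=
  lin_span [set v | exists k g,
    [/\ (k <= 1)%N, iterated_bracket f0 f1 f2 k g & v = g 0]].

Definition sum_set (A B : set Rn) : set Rn := [set a + b | a in A & b in B].

(* The norm of the library on 'rV[R]_n is the sup norm. *)
Definition euclidean_ball (c : Rn) (r : R) : set Rn :=
  [set x | Num.sqrt (\sum_(i < n) (x 0 i - c 0 i) ^+ 2) < r].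

End vector_fields.

Section control.
Context {R : realType}.
Local Notation mu := (@lebesgue_measure R).

Record is_norm (N : R * R -> R) : Prop := IsNorm {
  is_norm_triangle : forall u v, N (u + v) <= N u + N v ;
  is_norm_scale : forall (l : R) u, N (l * u.1, l * u.2) = `|l| * N u ;
  is_norm_eq0 : forall u, N u = 0 -> u = 0 }.

Definition Linfty_norm (N : R * R -> R) (T : R) (u : R -> R * R) : \bar R :=
  Lnorm (mrestr mu (measurable_itv `[0, T])) +oo%E (fun t => (N (u t))%:E).

(* Measurability is Borel, which loses no class: a Lebesgue measurable control
   is a.e. equal to a Borel one, and has the same solutions. *)
Definition in_Linfty (N : R * R -> R) (T : R) (u : R -> R * R) : Prop :=
  measurable_fun `[0, T] u /\ (Linfty_norm N T u < +oo)%E.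

Context {n : nat}.
Local Notation Rn := 'rV[R]_n.

(* Caratheodory solutions, in integral form: as z is continuous, this is the
   same as z being absolutely continuous and satisfying the equation a.e. *)
Definition is_solution (f0 f1 f2 : Rn -> Rn) (T : R) (u : R -> R * R)
    (z : R -> Rn) : Prop :=
  {within `[0, T], continuous z} /\
  forall t, t \in `[0, T] -> forall i : 'I_n,
    z t 0 i = z 0 0 i + \int[mu]_(s in `[0, t])
      (f0 (z s) + (u s).1 *: f1 (z s) + (u s).2 *: f2 (z s)) 0 i.

Definition alpha_STLC (N : R * R -> R) (f0 f1 f2 : Rn -> Rn) (alpha : R)
    (zeq : Rn) (ueq : R * R) : Prop :=
  forall eps : R, 0 < eps -> exists2 eta : R, 0 < eta &
    forall z0 z1, euclidean_ball zeq eta z0 -> euclidean_ball zeq eta z1 ->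
    exists (u : R -> R * R) (z : R -> Rn),
      [/\ in_Linfty N eps u, is_solution f0 f1 f2 eps u z,
          z 0 = z0, z eps = z1 &
          (Linfty_norm N eps (fun t => (u t - ueq)%R) <= (alpha + eps)%R%:E)%E].

Definition STLC (N : R * R -> R) (f0 f1 f2 : Rn -> Rn)
    (zeq : Rn) (ueq : R * R) : Prop :=
  alpha_STLC N f0 f1 f2 0 zeq ueq.

End control.

(* Main.v *)
Require Import Defs.
From mathcomp Require Import all_boot all_order all_algebra.
From mathcomp Require Import all_classical all_reals all_analysis.
From mathcomp Require Import measurable_realfun ess_sup_inf ring lra.
Import Order.TTheory GRing.Theory Num.Theory.
Import numFieldNormedType.Exports.
Local Open Scope classical_set_scope.
Local Open Scope ring_scope.

(** Write [b] for [f1 0], [A_i] for the differential of [f_i] at 0 and [y] for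
    the primitive of [u1] vanishing at time 0. To first order the state is
    [y *: b + xi], where [xi] is controlled by the integral [I] of [|y|]. As
    [f0] and [f2] vanish at 0, a bracket with one of them acts on values at 0
    through [A0] or [A2], so [R1] contains [b] and is stable under [A0] and
    [A2]: modulo [R1] the control [u1] has no first-order effect.

    The second-order effect appears once the motion along [f1] is removed from
    the state. Instead of the flow of [f1], a cubic Taylor polynomial of it is
    enough ([straightened]). Modulo [R1], the straightened state [w] satisfies
      [w' = w (A0 + u2 A2) - y^2 / 2 (B1 + u2 C) + error]
    with [C] the bracket of [f1] with [[f2, f1]] ([dstraightened_mod]). Put [E]
    for the integral of [y^2] over [[0, T]]. By Cauchy-Schwarz [I^2 <= T E], and
    every error term has integral of order [T E] ([remainder_bound]). Thus, if
    a linear form vanishing on [R1] stays above [c0 > 0] on [B1 + u2 C], its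
    value on the final state is at most [(- c0 / 2 + K T) E], which is
    nonpositive for small [T] ([obstruction]). The straightening is undone at
    the final time by terms of order [y(T)^2]; aiming at a target in a
    hyperplane transverse to [b] forces [y(T)] to be of order [I], so that
    these terms are also of order [T E].

    It remains to choose the form. If [B1 + beta C] lies in [R1], a form
    nonzero on [B1] takes on [B1 + u2 C] the value [(u2 - beta)] times its
    nonzero value on [C], whose sign is constant for [u2] near [u2eq]. If [B1]
    is not in [R1 + Span(C)], a form vanishing on [R1] and [C] but not on [B1]
    works for bounded controls of any size. In both cases the points of the
    transverse hyperplane on the positive side of the form are not reached from
    the origin.

    Solutions are integrals of measurable functions, and everything is done with
    one class of functions, the indefinite integrals of bounded measurable
    functions, which is stable under sums and products ([primitiveM]). The only
    fact used about analytic fields is a second-order expansion with a remainder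
    whose Lipschitz constant on the ball of radius [s] is of order [s^2]
    ([analytic_field_jet]); it yields both the estimates along trajectories and
    the values of the brackets at 0 ([second_bracket_at0]). *)


Set Implicit Arguments.
Unset Strict Implicit.
Unset Printing Implicit Defensive.

(** * Second-order jets of real analytic functions *)

Section monomials.
Context {R : realType} {n : nat}.
Implicit Types (x y : 'rV[R]_n) (k : {ffun 'I_n -> nat}).

Lemma rowD x y i : (x + y) 0 i = x 0 i + y 0 i. Proof. by rewrite mxE. Qed.
Lemma rowN x i : (- x) 0 i = - x 0 i. Proof. by rewrite mxE. Qed.
Lemma rowZ (a : R) x i : (a *: x) 0 i = a * x 0 i. Proof. by rewrite mxE. Qed.

Lemma row00 i : (0 : 'rV[R]_n) 0 i = 0. Proof. by rewrite mxE. Qed.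

(** Unlike [mxE], these rules leave matrix products folded, so that they remain
    atoms for [ring] and [field]. *)
Definition rvE := (rowD, rowN, rowZ, row00).

Lemma coord_le_norm x i : `|x 0 i| <= `|x|.
Proof.
rewrite [leRHS]/Num.norm /= mx_normrE.
by apply/bigmax_geP; right => /=; exists (0, i).
Qed.

Lemma norm_le_coord x (s : R) :
  0 <= s -> (forall i, `|x 0 i| <= s) -> `|x| <= s.
Proof.
move=> s0 xs; rewrite [leLHS]/Num.norm /= mx_normrE.
by apply/bigmax_leP; split => //= -[i j] _ /=; rewrite ord1.
Qed.

Definition monom k x : R := \prod_(i < n) x 0 i ^+ k i.

Definition mdegree k : nat := \sum_(i < n) k i.

Lemma monom_le k x (s : R) : `|x| <= s -> `|monom k x| <= s ^+ mdegree k.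
Proof.
move=> xs; rewrite /monom /mdegree.
elim/big_rec2: _ => [|i d p _ IH]; first by rewrite normr1.
rewrite normrM exprD ler_pM// normrX.
by rewrite lerXn2r ?nnegrE//= ?(le_trans _ xs)// coord_le_norm.
Qed.

Lemma powers_lip (u v s d : R) m : `|u| <= s -> `|v| <= s -> `|u - v| <= d ->
  `|u ^+ m - v ^+ m| <= m%:R * s ^+ m.-1 * d.
Proof.
move=> us vs uvd; rewrite subrXX normrM mulrC.
have s0 : 0 <= s by rewrite (le_trans _ us).
apply: ler_pM => //; apply: le_trans (ler_norm_sum _ _ _) _.
rewrite -[m in m%:R]card_ord -sum1_card natr_sum mulr_suml.
apply: ler_sum => i _; rewrite mul1r normrM !normrX.
have -> : m.-1 = (m.-1 - i + i)%N by rewrite subnK// -ltnS prednK// (leq_ltn_trans _ (ltn_ord i)).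
rewrite addnK exprD; apply: ler_pM; rewrite ?exprn_ge0//; exact: lerXn2r.
Qed.

Lemma monom_lip k x y (s : R) : `|x| <= s -> `|y| <= s ->
  `|monom k x - monom k y| <= (mdegree k)%:R * s ^+ (mdegree k).-1 * `|x - y|.
Proof.
move=> xs ys; have s0 : 0 <= s by rewrite (le_trans _ xs).
(* The induction over the factors also needs the bounds on the partial products. *)
suff: [/\ `|monom k x| <= s ^+ mdegree k , `|monom k y| <= s ^+ mdegree k &
  `|monom k x - monom k y| <= (mdegree k)%:R * s ^+ (mdegree k).-1 * `|x - y|].
  by case.
rewrite /monom /mdegree.
elim/big_rec3: _ => [|i p d q _ [IHq IHp IH]].
  by rewrite normr1 subrr normr0 !mul0r.
have xi : `|x 0 i ^+ k i| <= s ^+ k i.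
  by rewrite normrX lerXn2r ?nnegrE// (le_trans (coord_le_norm _ _)).
have yi : `|y 0 i ^+ k i| <= s ^+ k i.
  by rewrite normrX lerXn2r ?nnegrE// (le_trans (coord_le_norm _ _)).
split; [by rewrite normrM exprD ler_pM|by rewrite normrM exprD ler_pM|].
have -> : x 0 i ^+ k i * q - y 0 i ^+ k i * p =
   x 0 i ^+ k i * (q - p) + (x 0 i ^+ k i - y 0 i ^+ k i) * p by ring.
apply: le_trans (ler_normD _ _) _; rewrite !normrM.
have hx : `|x 0 i ^+ k i - y 0 i ^+ k i| <= (k i)%:R * s ^+ (k i).-1 * `|x - y|.
  apply: powers_lip; rewrite ?(le_trans (coord_le_norm _ _))//.
  by have := coord_le_norm (x - y) i; rewrite !mxE.
have h1 := ler_pM (normr_ge0 _) (normr_ge0 _) xi IH.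
have h2 := ler_pM (normr_ge0 _) (normr_ge0 _) hx IHp.
apply: le_trans (lerD h1 h2) _.
rewrite natrD.
case: (k i) d {IHp IHq IH h1 h2} => [|m] [|d'];
  rewrite ?mul0r ?mulr0 ?mul0r ?add0r ?addr0 ?expr0 ?mul1r ?mulr1 ?addn0 //=.
rewrite addnS !exprS exprD.
rewrite le_eqVlt; apply/orP; left; apply/eqP; ring.
Qed.

End monomials.

Section unconditional_sums.
Context {R : realType} {I : choiceType}.
Import finmap.

Lemma partial_sumE (a : I -> R) (A : {fset I}) :
  summability.partial_sum a A = \sum_(k <- A) a k.
Proof. by rewrite big_seq_fsetE. Qed.

Lemma cvg_totally_dist (a : I -> R) (l : R) :
  summability.partial_sum a A @[A --> summability.totally] --> l ->
  forall e : R, 0 < e ->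
  exists A0 : {fset I}, forall A, (A0 `<=` A)%fset -> `|l - \sum_(k <- A) a k| <= e.
Proof.
have F := @summability.totally_filter I.
move=> /cvgrPdist_le al e e0; have [A0 _ hA0] := al e e0.
by exists A0 => A /hA0 /=; rewrite partial_sumE.
Qed.

(** Convergence along finite sets is absolute: the sums over sets that avoid a
    suitable finite set [A0] are bounded by 2, and separating the positive terms
    from the negative ones bounds the sums of absolute values by 4. *)
Lemma abs_summable (a : I -> R) (l : R) :
  summability.partial_sum a A @[A --> summability.totally] --> l ->
  exists2 M : R, 0 <= M & forall A : {fset I}, \sum_(k <- A) `|a k| <= M.
Proof.
move=> /cvg_totally_dist /(_ 1 ltr01) [A0 hA0].
have disj (B : {fset I}) : [disjoint A0 & B]%fset -> `|\sum_(k <- B) a k| <= 2.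
  move=> dAB.
  have h1 := hA0 _ (fsubset_refl A0).
  have h2 := hA0 (A0 `|` B)%fset (fsubsetUl _ _).
  have e : \sum_(k <- (A0 `|` B)%fset) a k = \sum_(k <- A0) a k + \sum_(k <- B) a k.
    rewrite (big_fsetID _ (fun k => k \in A0))/=; congr (_ + _); apply: eq_fbigl => k.
      by rewrite !inE andb_orl andbb orb_idr// => /andP[].
    rewrite !inE andb_orl andbN /= andb_idr// => kB.
    by apply: contraL kB; exact: (fdisjointP dAB).
  have -> : \sum_(k <- B) a k =
    (l - \sum_(k <- A0) a k) - (l - \sum_(k <- (A0 `|` B)%fset) a k) by rewrite e; ring.
  by apply: le_trans (ler_normB _ _) _; lra.
have absdisj (B : {fset I}) : [disjoint A0 & B]%fset -> \sum_(k <- B) `|a k| <= 4.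
  move=> dAB; rewrite (big_fsetID _ (fun k => 0 <= a k))/=.
  have d1 : [disjoint A0 & [fset x in B | (0 <= a x)%R]]%fset.
    by apply: fdisjointWr dAB; exact: fset_sub.
  have d2 : [disjoint A0 & [fset x in B | ~~ (0 <= a x)%R]]%fset.
    by apply: fdisjointWr dAB; exact: fset_sub.
  have e1 : \sum_(k <- [fset x in B | (0 <= a x)%R]%fset) `|a k| =
            \sum_(k <- [fset x in B | (0 <= a x)%R]%fset) a k.
    rewrite big_seq [RHS]big_seq; apply: eq_bigr => k.
    by rewrite !inE /= => /andP[_ ak]; rewrite ger0_norm.
  have e2 : \sum_(k <- [fset x in B | ~~ (0 <= a x)%R]%fset) `|a k| =
            - \sum_(k <- [fset x in B | ~~ (0 <= a x)%R]%fset) a k.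
    rewrite big_seq [in RHS]big_seq -sumrN; apply: eq_bigr => k.
    by rewrite !inE /= -ltNge => /andP[_ ak]; rewrite ltr0_norm.
  rewrite e1 e2.
  have := disj _ d1; have := disj _ d2; rewrite !ler_norml => /andP[? ?] /andP[? ?].
  lra.
exists (\sum_(k <- A0) `|a k| + 4) => [|A].
  by rewrite addr_ge0// sumr_ge0.
rewrite (big_fsetID _ (fun k => k \in A0))/= lerD//.
  rewrite [leRHS](big_fsetID _ (fun k => k \in A))/=.
  have -> : [fset x in A | x \in A0]%fset = [fset x in A0 | x \in A]%fset.
    by apply/fsetP => k; rewrite !inE andbC.
  by rewrite lerDl sumr_ge0.
apply: absdisj; apply/fdisjointP => k kA0.
by rewrite !inE kA0 andbF.
Qed.

End unconditional_sums.

Section jets.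
Context {R : realType} {n : nat}.
Local Notation Rn := 'rV[R]_n.

(** The matrices [Q j] need not be symmetric, hence the two terms [qform Q x v]
    and [qform Q v x] of the derivative below. *)
Definition qform (Q : 'I_n -> 'M[R]_n) (x y : Rn) : Rn :=
  \row_j (x *m Q j *m y^T) 0 0.

Lemma low_degree_polynomial (a : {ffun 'I_n -> nat} -> R)
    (s : seq {ffun 'I_n -> nat}) : all (fun k => mdegree k <= 2)%N s ->
  exists (c : R) (L : 'cV[R]_n) (Q : 'M[R]_n), forall x : Rn,
    \sum_(k <- s) a k * monom k x = c + (x *m L) 0 0 + (x *m Q *m x^T) 0 0.
Proof.
pose quad (p : Rn -> R) := exists (c : R) (L : 'cV[R]_n) (Q : 'M[R]_n),
  forall x : Rn, p x = c + (x *m L) 0 0 + (x *m Q *m x^T) 0 0.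
have coordE (x : Rn) i : x 0 i = (x *m delta_mx i (0 : 'I_1)) 0 0.
  by rewrite -colE mxE.
have monomD k : (mdegree k <= 2)%N -> quad (monom k).
  have dec (k1 : {ffun 'I_n -> nat}) m : mdegree k1 = m.+1 -> exists i (k' : {ffun 'I_n -> nat}),
      mdegree k' = m /\ forall x : Rn, monom k1 x = x 0 i * monom k' x.
    move=> km; have [i ki] : exists i : 'I_n, (0 < k1 i)%N.
      apply: contrapT => /forallNP k0.
      have : mdegree k1 = 0%N.
        by apply: big1 => i _; apply/eqP; rewrite -leqn0 leqNgt; apply/negP/k0.
      by rewrite km.
    exists i, [ffun j => (k1 j - (j == i))%N]; split.
      move: km; rewrite /mdegree (bigD1 i)//= [in X in _ -> X](bigD1 i)//= ffunE eqxx.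
      rewrite [in X in _ -> X](eq_bigr k1); last by move=> j ji; rewrite ffunE (negbTE ji) subn0.
      by case: (k1 i) ki => // p _; rewrite addSn => -[<-]; rewrite subn1.
    move=> x; rewrite /monom (bigD1 i)//= [in RHS](bigD1 i)//= ffunE eqxx mulrA -exprS.
    rewrite subn1 prednK//; congr (_ * _); apply: eq_bigr => j ji.
    by rewrite ffunE (negbTE ji) subn0.
  have deg0 (k' : {ffun 'I_n -> nat}) (x : Rn) : mdegree k' = 0%N -> monom k' x = 1.
    move=> k0; apply: big1 => i _.
    have : (k' i <= mdegree k')%N by rewrite /mdegree (bigD1 i)//= leq_addr.
    by rewrite k0 leqn0 => /eqP ->.
  case km: (mdegree k) => [|[|[|//]]] _.
  - by exists 1, 0, 0 => x; rewrite deg0// !mulmx0 !mul0mx !mxE !addr0.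
  - have [i [k' [k'0 kE]]] := dec _ _ km.
    exists 0, (delta_mx i 0), 0 => x.
    by rewrite kE deg0// mulr1 coordE mulmx0 mul0mx !mxE add0r addr0.
  - have [i [k' [k'1 kE]]] := dec _ _ km.
    have [j [l [l0 k'E]]] := dec _ _ k'1.
    exists 0, 0, (delta_mx i j) => x.
    rewrite kE k'E deg0// mulr1 mulmx0 mxE !add0r.
    rewrite -(mul_delta_mx (0 : 'I_1)) !mulmxA -colE -mulmxA -rowE.
    by rewrite mxE big_ord1 !mxE.
elim: s => [_|k s IH /= /andP[/monomD[c [L [Q kE]]] /IH[c' [L' [Q' sE]]]]].
  by exists 0, 0, 0 => x; rewrite big_nil !mulmx0 !mul0mx !mxE !addr0.
exists (a k * c + c'), (a k *: L + L'), (a k *: Q + Q') => x.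
rewrite big_cons kE sE !mulmxDr !mulmxDl -!scalemxAr -!scalemxAl.
have addE (M M' : 'M[R]_1) : (M + M') 0 0 = M 0 0 + M' 0 0 by rewrite mxE.
have scaleE u (M : 'M[R]_1) : (u *: M) 0 0 = u * M 0 0 by rewrite mxE.
by rewrite !addE !scaleE; ring.
Qed.


(** The left-hand side is the Lipschitz constant, on the ball of radius [s], of
    a monomial of degree [m.+3]. Halving the radius of convergence absorbs the
    factor [m.+3], because [m.+3 <= 2 ^+ m.+3]. *)
Lemma scaled_degree_le (m : nat) (rho s : R) : 0 < rho -> 0 <= s ->
  s <= rho / 2 -> m.+3%:R * s ^+ m.+2 <= 8 / rho ^+ 3 * rho ^+ m.+3 * s ^+ 2.
Proof.
move=> rho0 s0 srho.
have h : m.+3%:R * s ^+ m <= 8 * rho ^+ m.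
  have h1 : s ^+ m <= (rho / 2) ^+ m by apply: lerXn2r; rewrite ?nnegrE// divr_ge0// ltW.
  have h2 : m.+3%:R <= 2 ^+ m.+3 :> R by rewrite -natrX ler_nat ltnW// ltn_expl.
  apply: le_trans (ler_pM _ _ h2 h1) _ => //; rewrite ?exprn_ge0//.
  rewrite expr_div_n !exprS mulrCA (mulrA 2 2) -!mulrA.
  have -> : 2 ^+ m / 2 ^+ m = 1 :> R by rewrite divff// expf_neq0.
  by rewrite mulr1 le_eqVlt; apply/orP; left; apply/eqP; ring.
have -> : m.+3%:R * s ^+ m.+2 = m.+3%:R * s ^+ m * s ^+ 2 by rewrite -mulrA -exprD addn2.
rewrite ler_wpM2r ?sqr_ge0//; apply: le_trans h _.
rewrite -(addn3 m) exprD (mulrC (_ ^+ m)) mulrA -(mulrA 8) mulVf ?mulr1//.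
by rewrite expf_neq0// gt_eqF.
Qed.

Import finmap.

Definition low_degrees : {fset {ffun 'I_n -> nat}} :=
  [fset k in [seq ([ffun i => val (k i)] : {ffun 'I_n -> nat})
             | k : {ffun 'I_n -> 'I_3}] | (mdegree k <= 2)%N]%fset.

Lemma low_degreesP (k : {ffun 'I_n -> nat}) :
  (k \in low_degrees) = (mdegree k <= 2)%N.
Proof.
rewrite !inE /= andb_idl// => k2.
have kl i : (k i < 3)%N by rewrite ltnS (leq_trans _ k2)// /mdegree (bigD1 i)//= leq_addr.
apply/mapP; exists [ffun i => Ordinal (kl i)]; first by rewrite mem_enum.
by apply/ffunP => i; rewrite !ffunE.
Qed.

(** The series converges absolutely at a corner of a small cube, so the
    Lipschitz constants of its terms of degree at least 3 are summable, with a
    sum of order [s ^+ 2]. *)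
Lemma analytic_jet (g : Rn -> R) (c : Rn) : real_analytic g ->
  exists (L : 'cV[R]_n) (Q : 'M[R]_n) (C rho : R), [/\ 0 < rho, 0 <= C &
    let r h := g (c + h) - (h *m L) 0 0 - (h *m Q *m h^T) 0 0 in
    forall s x y, s <= rho -> `|x| <= s -> `|y| <= s ->
      `|r x - r y| <= C * s ^+ 2 * `|x - y|].
Proof.
move=> /(_ c) [a].
rewrite -nbhs_nearE => /nbhs_ballP [d /= d0 ser].
have {}ser (h : Rn) : `|h| < d ->
    summability.partial_sum (fun k => a k * monom k h) A @[A --> summability.totally] --> g (c + h).
  move=> hd; have := ser (c + h); rewrite -ball_normE/= opprD addNKr normrN => /(_ hd).
  suff -> : (fun k : {ffun 'I_n -> nat} =>
       a k * (\prod_(i < n) ((c + h) 0 i - c 0 i) ^+ k i)%R) =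
       (fun k => a k * monom k h) by [].
  apply/funext => k; congr (_ * _); apply: eq_bigr => i _.
  by rewrite !mxE addrC addKr.
pose rho := d / 2; have rho0 : 0 < rho by rewrite divr_gt0.
have rhod : rho < d by rewrite /rho; lra.
have [M M0 hM] : exists2 M : R, 0 <= M &
    forall A : {fset {ffun 'I_n -> nat}}, \sum_(k <- A) `|a k| * rho ^+ mdegree k <= M.
  have hrho : `|const_mx rho : Rn| < d.
    rewrite (le_lt_trans _ rhod)// norm_le_coord ?ltW// => i.
    by rewrite mxE gtr0_norm.
  have [M M0 hM] := abs_summable (ser _ hrho).
  exists M => // A; apply: le_trans (hM A); apply: ler_sum => k _.
  have -> : monom k (const_mx rho : Rn) = rho ^+ mdegree k.
    by rewrite /monom /mdegree -prodrXr; apply: eq_bigr => i _; rewrite mxE.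
  by rewrite normrM [X in _ <= _ * X]ger0_norm// exprn_ge0// ltW.
have low2 : all (fun k : {ffun 'I_n -> nat} => mdegree k <= 2)%N low_degrees.
  by apply/allP => k; rewrite -low_degreesP.
have [c0 [L [Q lowE]]] := low_degree_polynomial a low2.
exists L, Q, (8 / rho ^+ 3 * M), (rho / 2); split.
- by rewrite divr_gt0.
- by rewrite mulr_ge0// divr_ge0// exprn_ge0// ltW.
move=> /= s x y srho xs ys.
have s0 : 0 <= s by rewrite (le_trans _ xs).
have sd : s < d by rewrite (le_lt_trans srho)// /rho; lra.
(* The bound on the tail is uniform in the finite set [A], and so passes to the
   limit. *)
have tail (A : {fset {ffun 'I_n -> nat}}) : (low_degrees `<=` A)%fset ->
  `|\sum_(k <- A) a k * monom k x - \sum_(k <- A) a k * monom k y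
    - (\sum_(k <- low_degrees) a k * monom k x
       - \sum_(k <- low_degrees) a k * monom k y)|
  <= 8 / rho ^+ 3 * M * s ^+ 2 * `|x - y|.
  move=> lA.
  have split (F : {ffun 'I_n -> nat} -> R) : \sum_(k <- A) F k =
      \sum_(k <- low_degrees) F k + \sum_(k <- A | (2 < mdegree k)%N) F k.
    rewrite (bigID (fun k => mdegree k <= 2)%N)/=; congr (_ + _).
      rewrite big_fset_condE/=; apply: eq_fbigl => k.
      rewrite [in RHS]low_degreesP !inE /= andb_idl// -low_degreesP.
      exact: (fsubsetP lA).
    by apply: eq_bigl => k; rewrite ltnNge.
  rewrite !split [X in `|X|](_ : _ =
      \sum_(k <- A | (2 < mdegree k)%N) a k * monom k x -
      \sum_(k <- A | (2 < mdegree k)%N) a k * monom k y); last by ring.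
  rewrite -sumrB; apply: le_trans (ler_norm_sum _ _ _) _.
  apply: (@le_trans _ _ (\sum_(k <- A | (2 < mdegree k)%N)
     (`|a k| * rho ^+ mdegree k) * (8 / rho ^+ 3 * s ^+ 2 * `|x - y|))).
    apply: ler_sum => k k2; rewrite -mulrBr normrM -mulrA ler_wpM2l//.
    apply: le_trans (monom_lip k xs ys) _; rewrite [leRHS]mulrCA mulrA.
    rewrite [leRHS](_ : _ = 8 / rho ^+ 3 * rho ^+ mdegree k * s ^+ 2 * `|x - y|).
      by case: (mdegree k) k2 => [|[|[|m]]]// _; rewrite ler_wpM2r//= scaled_degree_le.
    by ring.
  rewrite -mulr_suml.
  rewrite [leRHS](_ : _ = M * (8 / rho ^+ 3 * s ^+ 2 * `|x - y|)); last by ring.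
  apply: ler_wpM2r; first by rewrite !mulr_ge0// ?sqr_ge0// invr_ge0 exprn_ge0// ltW.
  apply: le_trans (hM A); rewrite [leRHS](bigID (fun k => 2 < mdegree k)%N)/= lerDl.
  by apply: sumr_ge0 => k _; rewrite mulr_ge0// exprn_ge0// ltW.
apply/ler_addgt0Pr => e e0.
have e2 : 0 < e / 2 by rewrite divr_gt0.
have [A1 hA1] := cvg_totally_dist (ser _ (le_lt_trans xs sd)) e2.
have [A2 hA2] := cvg_totally_dist (ser _ (le_lt_trans ys sd)) e2.
pose A := (low_degrees `|` (A1 `|` A2))%fset.
have lA : (low_degrees `<=` A)%fset by rewrite fsubsetUl.
have A1A : (A1 `<=` A)%fset by rewrite /A fsetUCA fsubsetUl.
have A2A : (A2 `<=` A)%fset by rewrite /A fsetUA fsubsetUr.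
have := tail _ lA; rewrite !lowE; have := hA1 _ A1A; have := hA2 _ A2A.
set B := _ * `|x - y|.
rewrite !ler_norml => /andP[? ?] /andP[? ?] /andP[? ?]; apply/andP; split; lra.
Qed.

End jets.
(** * Jets and derivatives of vector fields *)

Section field_jets.
Context {R : realType} {n : nat}.
Local Notation Rn := 'rV[R]_n.

Lemma mulmx_bounded (A : 'M[R]_n) :
  exists2 K : R, 0 <= K & forall x : Rn, `|x *m A| <= K * `|x|.
Proof.
exists (\sum_i \sum_j `|A i j|) => [|x].
  by apply: sumr_ge0 => i _; apply: sumr_ge0.
have K0 : 0 <= \sum_i \sum_j `|A i j| by apply: sumr_ge0 => i _; apply: sumr_ge0.
apply: norm_le_coord => [|j]; first by rewrite mulr_ge0.
rewrite mxE; apply: le_trans (ler_norm_sum _ _ _) _.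
rewrite mulr_suml; apply: ler_sum => i _; rewrite normrM mulrC.
apply: ler_pM => //; last exact: coord_le_norm.
by rewrite (bigD1 j)//= lerDl sumr_ge0.
Qed.

Lemma qform_bounded (Q : 'I_n -> 'M[R]_n) :
  exists2 K : R, 0 <= K & forall x y : Rn, `|qform Q x y| <= K * `|x| * `|y|.
Proof.
have K0 : 0 <= \sum_j \sum_i \sum_l `|Q j i l|.
  by apply: sumr_ge0 => i _; apply: sumr_ge0 => *; apply: sumr_ge0.
exists (\sum_j \sum_i \sum_l `|Q j i l|) => // x y.
apply: norm_le_coord => [|j]; first by rewrite !mulr_ge0.
rewrite !mxE.
apply: le_trans (ler_norm_sum _ _ _) _.
apply: (@le_trans _ _ (\sum_l \sum_i `|Q j i l| * (`|x| * `|y|))).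
  apply: ler_sum => l _; rewrite !mxE normrM -!mulr_suml mulrA.
  apply: ler_pM => //; last exact: coord_le_norm.
  apply: le_trans (ler_norm_sum _ _ _) _.
  rewrite mulr_suml; apply: ler_sum => i _; rewrite normrM mulrC.
  by apply: ler_pM => //; exact: coord_le_norm.
rewrite exchange_big/= -!mulrA; under eq_bigr do rewrite -mulr_suml.
rewrite -mulr_suml; apply: ler_wpM2r; first by rewrite mulr_ge0.
rewrite [leRHS](bigD1 j)//= lerDl; apply: sumr_ge0 => *.
by apply: sumr_ge0 => *; apply: sumr_ge0.
Qed.

Lemma qformE (Q : 'I_n -> 'M[R]_n) x y j : qform Q x y 0 j = (x *m Q j *m y^T) 0 0.
Proof. by rewrite mxE. Qed.

Lemma qformDl (Q : 'I_n -> 'M[R]_n) x x' y : qform Q (x + x') y = qform Q x y + qform Q x' y.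
Proof. by apply/rowP => j; rewrite [RHS]mxE !qformE !mulmxDl mxE. Qed.

Lemma qformDr (Q : 'I_n -> 'M[R]_n) x y y' : qform Q x (y + y') = qform Q x y + qform Q x y'.
Proof. by apply/rowP => j; rewrite [RHS]mxE !qformE linearD/= mulmxDr mxE. Qed.

Lemma qformZl (Q : 'I_n -> 'M[R]_n) a x y : qform Q (a *: x) y = a *: qform Q x y.
Proof. by apply/rowP => j; rewrite [RHS]mxE !qformE -!scalemxAl mxE. Qed.

Lemma qformZr (Q : 'I_n -> 'M[R]_n) a x y : qform Q x (a *: y) = a *: qform Q x y.
Proof. by apply/rowP => j; rewrite [RHS]mxE !qformE linearZ/= -!scalemxAr mxE. Qed.

Definition jet_rem (f : Rn -> Rn) c A Q (h : Rn) : Rn :=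
  f (c + h) - f c - h *m A - qform Q h h.

Lemma qformBl (Q : 'I_n -> 'M[R]_n) x x' y : qform Q (x - x') y = qform Q x y - qform Q x' y.
Proof. by rewrite qformDl -(scaleN1r x') qformZl scaleN1r. Qed.

Lemma qformBr (Q : 'I_n -> 'M[R]_n) x y y' : qform Q x (y - y') = qform Q x y - qform Q x y'.
Proof. by rewrite qformDr -(scaleN1r y') qformZr scaleN1r. Qed.

(** A second-order expansion of [f] at [c] whose remainder is Lipschitz with a
    constant of order 2: this controls the remainder itself to order 3, and its
    derivative to order 2. *)
Definition has_jet (f : Rn -> Rn) c A Q (C rho : R) :=
  forall s x y, s <= rho -> `|x| <= s -> `|y| <= s ->
      `|jet_rem f c A Q x - jet_rem f c A Q y| <= C * s ^+ 2 * `|x - y|.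

Lemma analytic_field_jet (f : Rn -> Rn) (c : Rn) : real_analytic_field f ->
  exists A Q C rho, [/\ 0 < rho, 0 <= C & has_jet f c A Q C rho].
Proof.
move=> fan.
have H i : exists p : 'cV[R]_n * 'M[R]_n * R * R, [/\ 0 < p.2, 0 <= p.1.2 &
    let r h := f (c + h) 0 i - (h *m p.1.1.1) 0 0 - (h *m p.1.1.2 *m h^T) 0 0 in
    forall s x y, s <= p.2 -> `|x| <= s -> `|y| <= s ->
      `|r x - r y| <= p.1.2 * s ^+ 2 * `|x - y|].
  have [L [Q [C [rho h]]]] := analytic_jet c (fan i).
  by exists (L, Q, C, rho).
have [p hp] := choice H.
exists (\matrix_(i, j) (p j).1.1.1 i 0), (fun j => (p j).1.1.2).
exists (\sum_i (p i).1.2), (\big[Num.min/1]_i (p i).2); split.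
- elim/big_ind: _ => [|u v u0 v0|i _]; rewrite ?ltr01 ?lt_min ?u0//.
  by case: (hp i).
- by apply: sumr_ge0 => i _; case: (hp i).
move=> s x y srho xs ys.
have C0 : 0 <= \sum_i (p i).1.2 by apply: sumr_ge0 => i _; case: (hp i).
apply: norm_le_coord => [|i]; first by rewrite mulr_ge0// mulr_ge0//; exact: sqr_ge0.
have [_ Ci /= h] := hp i.
have sp : s <= (p i).2 by apply: le_trans srho _; exact: bigmin_le_cond.
apply: (@le_trans _ _ ((p i).1.2 * s ^+ 2 * `|x - y|)); last first.
  apply: ler_wpM2r => //; apply: ler_wpM2r; first exact: sqr_ge0.
  by rewrite (bigD1 i)//= lerDl sumr_ge0// => j _; case: (hp j).
apply: le_trans (h s x y sp xs ys); rewrite le_eqVlt; apply/orP; left; apply/eqP.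
have LE (z : Rn) : (z *m \matrix_(i, j) (p j).1.1.1 i 0) 0 i = (z *m (p i).1.1.1) 0 0.
  by rewrite !mxE; apply: eq_bigr => j _; rewrite mxE.
rewrite /jet_rem !rvE !LE !qformE.
by congr `| _ |; ring.
Qed.

Section at_a_point.
Variables (f : Rn -> Rn) (A : 'M[R]_n) (Q : 'I_n -> 'M[R]_n) (C rho : R).

Lemma jet_rem0 c : jet_rem f c A Q 0 = 0.
Proof.
apply/rowP => i; rewrite /jet_rem addr0 subrr mul0mx.
by rewrite -(scale0r (0 : Rn)) qformZl !scale0r !subr0.
Qed.

Lemma jet_rem_le c x : has_jet f c A Q C rho ->
  `|x| <= rho -> `|jet_rem f c A Q x| <= C * `|x| ^+ 3.
Proof.
move=> J xr; have := J `|x| x 0 xr (lexx _).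
by rewrite normr0 jet_rem0 !subr0 => /(_ (normr_ge0 _)) h; rewrite (exprSr _ 2) mulrA.
Qed.

Lemma jet_expand c h :
  f (c + h) = f c + h *m A + qform Q h h + jet_rem f c A Q h.
Proof. by rewrite /jet_rem; apply/rowP => i; rewrite !rvE; ring. Qed.

End at_a_point.

Section derivatives.
Variables (f : Rn -> Rn) (A : 'M[R]_n) (Q : 'I_n -> 'M[R]_n) (C rho : R).

Lemma jet_derive c v : 0 < rho -> 0 <= C -> has_jet f c A Q C rho ->
  h^-1 *: (f (h *: v + c) - f c) @[h --> 0^'] --> v *m A.
Proof.
move=> rho0 C0 J; apply/cvgrPdist_le => e e0.
have [K K0 hK] := qform_bounded Q.
have v1 : 0 < `|v| + 1 by rewrite ltr_wpDl.
pose d := Num.min (rho / (`|v| + 1)) (Num.min 1 (e / (K * `|v| ^+ 2 + C * `|v| ^+ 3 + 1))).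
have D0 : 0 < K * `|v| ^+ 2 + C * `|v| ^+ 3 + 1.
  by rewrite ltr_wpDl// addr_ge0// mulr_ge0// exprn_ge0.
have d0 : 0 < d by rewrite !lt_min ltr01 !divr_gt0.
near=> h.
have h0 : h != 0 by near: h; exact: nbhs_dnbhs_neq.
have hd : `|h| < d.
  near: h; apply: dnbhs0_lt; exact: d0.
have h1 : `|h| < 1 by apply: lt_le_trans hd _; rewrite /d !ge_min lexx orbT.
have hv : `|h *: v| <= rho.
  have : `|h| <= rho / (`|v| + 1) by apply: ltW; apply: lt_le_trans hd _; rewrite /d !ge_min lexx.
  rewrite ler_pdivlMr// => hh; rewrite normrZ (le_trans _ hh)// ler_wpM2l// lerDl//.
have he : `|h| * (K * `|v| ^+ 2 + C * `|v| ^+ 3 + 1) <= e.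
  by rewrite -ler_pdivlMr//; apply: ltW; apply: lt_le_trans hd _; rewrite /d !ge_min lexx !orbT.
rewrite (addrC (h *: v) c) (jet_expand f A Q).
have -> : v *m A - h^-1 *: (f c + (h *: v) *m A + qform Q (h *: v) (h *: v) + jet_rem f c A Q (h *: v) - f c)
  = - (h *: qform Q v v + h^-1 *: jet_rem f c A Q (h *: v)).
  rewrite qformZl qformZr -scalemxAl.
  apply/rowP => i; rewrite !rvE.
  by field.
rewrite normrN; apply: le_trans (ler_normD _ _) _; apply: le_trans he.
have q1 := hK v v; have r1 := jet_rem_le J hv.
have h0' : 0 < `|h| by rewrite normr_gt0.
have r2 : `|h^-1 *: jet_rem f c A Q (h *: v)| <= `|h| * (C * `|v| ^+ 3).
  rewrite normrZ normfV mulrC ler_pdivrMr//; apply: le_trans r1 _.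
  rewrite normrZ exprMn [leRHS](_ : _ = C * (`|h| ^+ 2 * `|v| ^+ 3)); last by ring.
  rewrite ler_wpM2l// ler_wpM2r ?exprn_ge0// (exprS _ 2).
  by rewrite ler_piMl ?exprn_ge0// ltW.
have r3 : `|h *: qform Q v v| <= `|h| * (K * `|v| ^+ 2).
  by rewrite normrZ ler_wpM2l// expr2 mulrA.
lra.
Unshelve. all: by end_near. Qed.

Lemma jet_deriveE c v : 0 < rho -> 0 <= C -> has_jet f c A Q C rho ->
  'D_v f c = v *m A.
Proof. by move=> r0 C0 J; apply: cvg_lim => //; exact: jet_derive. Qed.

(** The derivative in the direction [v] is affine up to an error of order 2;
    this is where the Lipschitz form of the remainder is used. *)
Lemma jet_derive_near x v (l : Rn) : 0 < rho -> 0 <= C ->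
  has_jet f 0 A Q C rho -> `|x| < rho ->
  h^-1 *: (f (h *: v + x) - f x) @[h --> 0^'] --> l ->
  `|l - (v *m A + qform Q x v + qform Q v x)| <= C * `|x| ^+ 2 * `|v|.
Proof.
move=> rho0 C0 J xr fl.
set L := v *m A + _ + _.
pose k := fun h : R => `|h^-1 *: (f (h *: v + x) - f x) - (L + h *: qform Q v v)|.
have idc : h @[h --> (0 : R)^'] --> (0 : R) by apply: cvg_within_filter; exact: cvg_id.
have cv1 : h *: qform Q v v @[h --> (0 : R)^'] --> (0 : Rn).
  rewrite -[X in _ --> X](scale0r (qform Q v v)).
  exact: cvgZr_tmp idc.
have cvk : k h @[h --> (0 : R)^'] --> `|l - L|.
  apply: cvg_norm; apply: cvgB => //.
  rewrite -[X in _ --> X]addr0; apply: cvgD => //; exact: cvg_cst.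
have cvb : C * (`|x| + `|h| * `|v|) ^+ 2 * `|v| @[h --> (0 : R)^'] --> C * `|x| ^+ 2 * `|v|.
  apply: cvgMr_tmp; apply: cvgMl_tmp.
  have cn : `|h| @[h --> (0 : R)^'] --> (0 : R).
    rewrite -[X in _ --> X](@normr0 _ R); apply: cvg_norm; exact: idc.
  have c2 : `|x| + `|h| * `|v| @[h --> (0 : R)^'] --> `|x|.
    rewrite -[X in _ --> X]addr0 -[X in _ --> _ + X](mul0r `|v|).
    apply: cvgD; first exact: cvg_cst.
    exact: (cvgMr_tmp cn).
  exact: (cvgM c2 c2).
apply: (ler_cvg_to cvk cvb).
near=> h.
have h0 : h != 0 by near: h; exact: nbhs_dnbhs_neq.
have hd : `|h| < (rho - `|x|) / (`|v| + 1).
  near: h; apply: dnbhs0_lt; rewrite divr_gt0 ?subr_gt0// ltr_wpDl//.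
have v1 : 0 < `|v| + 1 by rewrite ltr_wpDl.
have hv : `|x| + `|h| * `|v| <= rho.
  move: hd; rewrite ltr_pdivlMr// => hd.
  have : `|h| * `|v| <= `|h| * (`|v| + 1) by rewrite ler_wpM2l// lerDl.
  lra.
rewrite /k.
have -> : h^-1 *: (f (h *: v + x) - f x) - (L + h *: qform Q v v) =
  h^-1 *: (jet_rem f 0 A Q (x + h *: v) - jet_rem f 0 A Q x).
  have e1 := jet_expand f A Q 0 (x + h *: v).
  have e2 := jet_expand f A Q 0 x.
  rewrite add0r in e1; rewrite add0r in e2.
  rewrite (addrC (h *: v) x) e1 e2 mulmxDl !qformDl !qformDr !qformZl !qformZr -scalemxAl /L.
  apply/rowP => i; rewrite !rvE.
  by field.
have n1 : `|x| <= `|x| + `|h| * `|v| by rewrite lerDl mulr_ge0.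
have n2 : `|x + h *: v| <= `|x| + `|h| * `|v| by rewrite -normrZ ler_normD.
have := J _ _ _ hv n2 n1; rewrite [x + _]addrC addrK normrZ => JJ.
have h0' : 0 < `|h| by rewrite normr_gt0.
rewrite normrZ normfV mulrC ler_pdivrMr//; apply: le_trans JJ _.
by rewrite le_eqVlt; apply/orP; left; apply/eqP; ring.
Unshelve. all: by end_near. Qed.

End derivatives.

Lemma analytic_field_derive (f : Rn -> Rn) x v : real_analytic_field f ->
  h^-1 *: (f (h *: v + x) - f x) @[h --> 0^'] --> 'D_v f x.
Proof.
move=> /(@analytic_field_jet f x) [A [Q [C [rho [rho0 C0 J]]]]].
by rewrite (jet_deriveE v rho0 C0 J); exact: (jet_derive rho0 C0 J).
Qed.

Lemma analytic_field_continuous (f : Rn -> Rn) : real_analytic_field f ->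
  continuous f.
Proof.
move=> fan; move=> /= c; have [A [Q [C [rho [rho0 C0 J]]]]] := analytic_field_jet c fan.
have [KA KA0 hA] := mulmx_bounded A.
have [KQ KQ0 hQ] := qform_bounded Q.
apply/(@cvgrPdist_le _ _ _ (nbhs (c : Rn))) => e e0.
pose d := Num.min rho (Num.min 1 (e / (KA + KQ + C + 1))).
have D0 : 0 < KA + KQ + C + 1 by rewrite ltr_wpDl// !addr_ge0.
have d0 : 0 < d by rewrite !lt_min ltr01 rho0 divr_gt0.
near=> x.
have : `|x - c| < d.
  near: x; apply/nbhs_ballP; exists d => //= y.
  by rewrite -ball_normE/= distrC.
have -> : f x = f (c + (x - c)) by rewrite addrC subrK.
set h := x - c => hd.
have h1 : `|h| <= 1 by apply: ltW; apply: lt_le_trans hd _; rewrite /d !ge_min lexx orbT.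
have hr : `|h| <= rho by apply: ltW; apply: lt_le_trans hd _; rewrite /d !ge_min lexx.
have he : `|h| * (KA + KQ + C + 1) <= e.
  by rewrite -ler_pdivlMr//; apply: ltW; apply: lt_le_trans hd _; rewrite /d !ge_min lexx !orbT.
rewrite (jet_expand f A Q) -!addrA opprD addNKr normrN.
apply: le_trans he; apply: le_trans (ler_normD _ _) _.
have := ler_normD (qform Q h h) (jet_rem f c A Q h).
have := hA h; have := hQ h h; have := jet_rem_le J hr.
have h2 : `|h| * `|h| <= `|h| by rewrite ler_piMl.
have h3 : `|h| ^+ 3 <= `|h| by rewrite exprS ler_piMr// exprn_ile1.
have := ler_wpM2l KQ0 h2; have := ler_wpM2l C0 h3; have := normr_ge0 h.
lra.
Unshelve. all: by end_near. Qed.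

End field_jets.
(** * Lie brackets at a zero of the drift *)

Section second_bracket.
Context {R : realType} {n : nat}.
Local Notation Rn := 'rV[R]_n.

Lemma cvg_le_dist {F : set_system R} {FF : ProperFilter F} (u : R -> Rn) (l : Rn)
    (e : R -> R) :
  (\forall h \near F, `|u h - l| <= e h) -> e @ F --> (0 : R) -> u @ F --> l.
Proof.
move=> ue e0; apply/cvgrPdist_le => d d0; near=> h.
rewrite distrC; apply: (@le_trans _ _ (e h)); first by near: h.
have : `|e h| <= d by near: h; apply: cvgr0_norm_le.
exact: le_trans (ler_norm _).
Unshelve. all: by end_near. Qed.

Lemma cvg_mulmx {F : set_system R} {FF : ProperFilter F} (u : R -> Rn) (l : Rn)
  (A : 'M[R]_n) : u @ F --> l -> u h *m A @[h --> F] --> l *m A.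
Proof.
move=> ul; have [K K0 hK] := mulmx_bounded A.
apply: (@cvg_le_dist F FF _ _ (fun h => K * `|u h - l|)).
  by apply: nearW => h; rewrite -mulmxBl.
rewrite -[X in _ --> X](mulr0 K); apply: cvgMl_tmp.
by apply/norm_cvg0P; rewrite -[X in _ --> X](subrr l); apply: cvgB => //; exact: cvg_cst.
Qed.

Lemma cvg_qform {F : set_system R} {FF : ProperFilter F} (u w : R -> Rn)
  (l m : Rn) (Q : 'I_n -> 'M[R]_n) : u @ F --> l -> w @ F --> m ->
  qform Q (u h) (w h) @[h --> F] --> qform Q l m.
Proof.
move=> ul wm; have [K K0 hK] := qform_bounded Q.
apply: (@cvg_le_dist F FF _ _ (fun h => K * (`|u h - l| * `|w h| + `|l| * `|w h - m|))).
  apply: nearW => h.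
  have -> : qform Q (u h) (w h) - qform Q l m = qform Q (u h - l) (w h) + qform Q l (w h - m).
    rewrite qformBl qformBr.
    by apply/rowP => i; rewrite !rvE; ring.
  apply: le_trans (ler_normD _ _) _.
  by have := hK (u h - l) (w h); have := hK l (w h - m); rewrite mulrDr -!mulrA; lra.
have z (k : Rn) (v : R -> Rn) : v @ F --> k -> `|v h - k| @[h --> F] --> (0 : R).
  by move=> vk; apply/norm_cvg0P; rewrite -[X in _ --> X](subrr k); apply: cvgB => //; exact: cvg_cst.
rewrite -[X in _ --> X](mulr0 K) -[X in _ * X](addr0 0) -[X in X + _](mul0r `|m|) -[X in _ + X](mulr0 `|l|).
apply: cvgMl_tmp; apply: cvgD; last by apply: cvgMl_tmp; exact: z.
by apply: cvgM; [exact: z|exact: cvg_norm].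
Qed.

(** Only the derivative of [f] survives, because the derivative of [g] is taken
    in the direction [f 0 = 0]; this holds whatever the regularity of [g]. *)
Lemma bracket_at0 (f g : Rn -> Rn) A Q (C rho : R) : 0 < rho -> 0 <= C ->
  has_jet f 0 A Q C rho -> f 0 = 0 -> lie_bracket f g 0 = - (g 0 *m A).
Proof.
move=> r0 C0 J f0; rewrite /lie_bracket f0 derive0 sub0r.
by rewrite (jet_deriveE _ r0 C0 J).
Qed.

(** The inner bracket is differentiated along the line spanned by [g 0]: there
    the derivatives of [f] and [g] are affine up to an error of order 2, which
    disappears in the difference quotient. *)
Lemma second_bracket_at0 (f g : Rn -> Rn) A Q A1 Q1 (C rho : R) :
  real_analytic_field f -> real_analytic_field g ->
  0 < rho -> 0 <= C ->
  has_jet f 0 A Q C rho -> has_jet g 0 A1 Q1 C rho -> f 0 = 0 ->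
  lie_bracket g (lie_bracket f g) 0 =
  2 *: (g 0 *m A *m A1) - g 0 *m A1 *m A - 2 *: qform Q (g 0) (g 0).
Proof.
move=> fan gan r0 C0 Jf Jg f0.
set b := g 0.
rewrite {1}/lie_bracket (bracket_at0 g r0 C0 Jf f0) (jet_deriveE _ r0 C0 Jg) -/b.
rewrite mulNmx opprK.
suff -> : 'D_b (lie_bracket f g) 0 = b *m A *m A1 - b *m A1 *m A - 2 *: qform Q b b.
  by apply/rowP => i; rewrite !rvE; ring.
apply: cvg_lim => //.
have idc : h @[h --> (0 : R)^'] --> (0 : R) by apply: cvg_within_filter; exact: cvg_id.
have hb0 : h *: b @[h --> (0 : R)^'] --> (0 : Rn).
  by rewrite -[X in _ --> X](scale0r b); exact: cvgZr_tmp.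
have vb : h^-1 *: f (h *: b) @[h --> (0 : R)^'] --> b *m A.
  have := jet_derive (v := b) r0 C0 Jf; rewrite f0.
  by under eq_fun do rewrite addr0 subr0.
have wb : h^-1 *: (g (h *: b) - b) @[h --> (0 : R)^'] --> b *m A1.
  by have := jet_derive (v := b) r0 C0 Jg; under eq_fun do rewrite addr0.
have v0 : f (h *: b) @[h --> (0 : R)^'] --> (0 : Rn).
  have cf : f y @[y --> (0 : Rn)] --> f 0 by exact: (@analytic_field_continuous _ _ f fan).
  by have := cvg_comp _ _ hb0 cf; rewrite f0.
have w0 : g (h *: b) @[h --> (0 : R)^'] --> b.
  have cg : g y @[y --> (0 : Rn)] --> g 0 by exact: (@analytic_field_continuous _ _ g gan).
  exact: (cvg_comp _ _ hb0 cg).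
pose E1 h : Rn := 'D_(f (h *: b)) g (h *: b) - (f (h *: b) *m A1
   + qform Q1 (h *: b) (f (h *: b)) + qform Q1 (f (h *: b)) (h *: b)).
pose E2 h : Rn := 'D_(g (h *: b)) f (h *: b) - (g (h *: b) *m A
   + qform Q (h *: b) (g (h *: b)) + qform Q (g (h *: b)) (h *: b)).
have Ecvg (G : Rn -> Rn) (l : Rn) (E : R -> Rn) :
    G (h *: b) @[h --> (0 : R)^'] --> l ->
    (\forall h \near (0 : R)^', `|E h| <= C * `|h *: b| ^+ 2 * `|G (h *: b)|) ->
    h^-1 *: E h @[h --> (0 : R)^'] --> (0 : Rn).
  move=> Gl Eb.
  apply: (@cvg_le_dist _ _ _ _ (fun h => `|h| * (C * `|b| ^+ 2 * `|G (h *: b)|))).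
    near=> h; rewrite subr0 normrZ normfV.
    have h0 : h != 0 by near: h; exact: nbhs_dnbhs_neq.
    have h0' : 0 < `|h| by rewrite normr_gt0.
    have : `|E h| <= C * `|h *: b| ^+ 2 * `|G (h *: b)| by near: h.
    rewrite ler_pdivrMl//= normrZ => hE; apply: le_trans hE _.
    by rewrite le_eqVlt; apply/orP; left; apply/eqP; ring.
  rewrite -[X in _ --> X](mul0r (C * `|b| ^+ 2 * `|l|)).
  apply: cvgM; last by apply: cvgMl_tmp; exact: cvg_norm.
  by rewrite -[X in _ --> X](@normr0 _ R); apply: cvg_norm; exact: idc.
have small : \forall h \near (0 : R)^', `|h *: b| < rho.
  exact: (cvgr0_norm_lt _ hb0).
have E10 : h^-1 *: E1 h @[h --> (0 : R)^'] --> (0 : Rn).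
  apply: (Ecvg f _ _ v0); near=> h.
  apply: (jet_derive_near r0 C0 Jg); first by near: h.
  exact: analytic_field_derive.
have E20 : h^-1 *: E2 h @[h --> (0 : R)^'] --> (0 : Rn).
  apply: (Ecvg g _ _ w0); near=> h.
  apply: (jet_derive_near r0 C0 Jf); first by near: h.
  exact: analytic_field_derive.
have <- : (b *m A *m A1 + (qform Q1 b 0 + qform Q1 0 b) + 0)
    - (b *m A1 *m A + (qform Q b b + qform Q b b) + 0) =
    b *m A *m A1 - b *m A1 *m A - 2 *: qform Q b b.
  rewrite -(scale0r (0 : Rn)) qformZl qformZr !scale0r.
  by apply/rowP => i; rewrite !rvE; ring.
refine (cvg_trans _ (cvgB
  (cvgD (cvgD (cvg_mulmx (A := A1) vb) (cvgD (cvg_qform (Q := Q1) (cvg_cst b) v0) (cvg_qform (Q := Q1) v0 (cvg_cst b)))) E10)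
  (cvgD (cvgD (cvg_mulmx (A := A) wb) (cvgD (cvg_qform (Q := Q) (cvg_cst b) w0) (cvg_qform (Q := Q) w0 (cvg_cst b)))) E20))); apply: near_eq_cvg; near=> h.
have h0 : h != 0 by near: h; exact: nbhs_dnbhs_neq.
rewrite !fctE /shift/= addr0 (bracket_at0 g r0 C0 Jf f0) opprK /lie_bracket.
have -> : 'D_(f (h *: b)) g (h *: b) = E1 h + (f (h *: b) *m A1
   + qform Q1 (h *: b) (f (h *: b)) + qform Q1 (f (h *: b)) (h *: b)).
  by rewrite /E1 subrK.
have -> : 'D_(g (h *: b)) f (h *: b) = E2 h + (g (h *: b) *m A
   + qform Q (h *: b) (g (h *: b)) + qform Q (g (h *: b)) (h *: b)).
  by rewrite /E2 subrK.
rewrite !qformZl !qformZr -!scalemxAl mulmxBl /=.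
by apply/rowP => i; rewrite !rvE; field.
Unshelve. all: by end_near. Qed.

End second_bracket.
(** * Indefinite integrals of bounded functions *)

Section primitives.
Context {R : realType}.
Local Notation mu := (@lebesgue_measure R).
Variable T : R.
Implicit Types (F G f g : R -> R).

(** The bound on the density makes [F] Lipschitz, which is what the product rule
    relies on. *)
Definition primitive F f :=
  [/\ measurable_fun `[0, T] f,
      exists M : R, forall t, 0 <= t <= T -> `|f t| <= M &
      forall t, 0 <= t <= T -> F t = F 0 + \int[mu]_(s in `[0, t]) f s].

Lemma bounded_integrable f a b : 0 <= a -> b <= T ->
  measurable_fun `[0, T] f ->
  (exists M : R, forall t, 0 <= t <= T -> `|f t| <= M) ->
  mu.-integrable `[a, b] (EFin \o f).
Proof.
move=> a0 bT mf [M fM]; apply: measurable_bounded_integrable => //.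
- by rewrite /= lebesgue_measure_itv/=; case: ifPn => // _; rewrite -EFinB ltry.
- apply: measurable_funS mf => //; apply: subset_itv; rewrite bnd_simp//.
- exists M; split; rewrite ?num_real// => x Mx y /=; rewrite in_itv/= => /andP[ay yb].
  by rewrite (le_trans (fM _ _) (ltW Mx))// (le_trans a0)//= (le_trans yb).
Qed.

Lemma primitive_integral f : measurable_fun `[0, T] f ->
  (exists M : R, forall t, 0 <= t <= T -> `|f t| <= M) ->
  primitive (fun t => \int[mu]_(s in `[0, t]) f s) f.
Proof.
by move=> mf bf; split => // t _; rewrite set_itv1 Rintegral_set1 add0r.
Qed.

Lemma primitive_incr F f s t : primitive F f -> 0 <= s -> s <= t -> t <= T ->
  F t - F s = \int[mu]_(r in `[s, t]) f r.
Proof.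
move=> [mf bf Fint] s0 st tT.
have t0 : 0 <= t by rewrite (le_trans s0).
have sT : s <= T by rewrite (le_trans st).
rewrite (Fint t) ?t0// (Fint s) ?s0// opprD addrACA subrr add0r.
rewrite (@Rintegral_itvB _ _ (BLeft 0) (BRight t))//; [|exact: bounded_integrable..].
rewrite Rintegral_itv_obnd_cbnd//.
have := bounded_integrable s0 tT mf bf; apply: integrableS => //.
by apply: subset_itv; rewrite bnd_simp.
Qed.

Lemma le_primitive F f G g s t : primitive F f -> primitive G g ->
  0 <= s -> s <= t -> t <= T -> (forall r, s <= r <= t -> f r <= g r) ->
  F t - F s <= G t - G s.
Proof.
move=> PF PG s0 st tT fg; rewrite (primitive_incr PF)// (primitive_incr PG)//.
have [mf bf _] := PF; have [mg bg _] := PG.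
apply: le_Rintegral => //.
- by have := bounded_integrable s0 tT mf bf.
- by have := bounded_integrable s0 tT mg bg.
Qed.

Lemma primitiveD F f G g : primitive F f -> primitive G g ->
  primitive (fun t => F t + G t) (fun t => f t + g t).
Proof.
move=> [mf bf Fint] [mg bg Gint]; split; first exact: measurable_funD.
- have [M fM] := bf; have [N gN] := bg; exists (M + N) => t tT.
  by rewrite (le_trans (ler_normD _ _))// lerD ?fM ?gN.
- move=> t tT; have /andP[_ tT'] := tT.
  rewrite RintegralD//; [|exact: bounded_integrable..].
  by rewrite Fint// Gint// addrACA.
Qed.

Lemma primitiveZ (a : R) F f : primitive F f ->
  primitive (fun t => a * F t) (fun t => a * f t).
Proof.
move=> [mf bf Fint]; split; first by apply: measurable_funM => //; exact: measurable_cst.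
- have [M fM] := bf; exists (`|a| * M) => t tT.
  by rewrite normrM ler_wpM2l// fM.
- move=> t tT; have /andP[_ tT'] := tT.
  have ? : mu.-integrable `[0, t] (EFin \o f) by exact: bounded_integrable.
  by rewrite RintegralZl// Fint// mulrDr.
Qed.

Lemma primitive_cst (a : R) : primitive (fun=> a) (fun=> 0).
Proof.
split; first exact: measurable_cst; first by exists 0 => t _; rewrite normr0.
by move=> t _; rewrite Rintegral_cst//= mul0r addr0.
Qed.

Lemma primitive_id : primitive id (fun=> 1).
Proof.
split; first exact: measurable_cst; first by exists 1 => t _; rewrite normr1.
move=> t /andP[t0 _]; rewrite Rintegral_cst//= add0r mul1r.
rewrite lebesgue_measure_itv/= lte_fin.
by move: t0; rewrite le_eqVlt => /predU1P[<-|t0]; rewrite ?ltxx ?t0/= ?subr0.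
Qed.

Lemma eq_primitive F f G g : primitive F f ->
  (forall t, 0 <= t <= T -> F t = G t) -> (forall t, 0 <= t <= T -> f t = g t) ->
  primitive G g.
Proof.
move=> [mf [M fM] Fint] FG fg; split.
- apply: eq_measurable_fun mf => t; rewrite inE/= in_itv/=; exact: fg.
- by exists M => t tT; rewrite -fg// fM.
- move=> t tT; have /andP[t0 tT'] := tT.
  rewrite -!FG// ?lexx ?(le_trans t0)// Fint//; congr (_ + _).
  apply: eq_Rintegral => r; rewrite inE/= in_itv/= => /andP[r0 rt].
  by rewrite fg// r0 (le_trans rt).
Qed.

Lemma primitive_lip F f : primitive F f ->
  exists2 M : R, 0 <= M & forall s t, 0 <= s -> s <= t -> t <= T ->
    `|F t - F s| <= M * (t - s).
Proof.
move=> PF; have [mf [M fM] _] := PF.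
have PM := primitiveZ M primitive_id.
have PMN := primitiveZ (- M) primitive_id.
exists `|M| => // s t s0 st tT.
have fMr r : s <= r <= t -> - M <= f r <= M.
  by move=> /andP[sr rt]; rewrite -ler_norml fM// (le_trans s0)//= (le_trans rt).
have h1 : F t - F s <= M * t - M * s.
  by apply: (le_primitive PF PM) => // r /fMr /andP[]; rewrite mulr1.
have h2 : - M * t - - M * s <= F t - F s.
  by apply: (le_primitive PMN PF) => // r /fMr /andP[]; rewrite mulr1.
have h3 : M * (t - s) <= `|M| * (t - s) by rewrite ler_wpM2r ?subr_ge0// ler_norm.
by rewrite ler_norml; apply/andP; split; lra.
Qed.

Lemma lipschitz_within_continuous (F : R -> R) (M : R) : 0 <= M ->
  (forall s t, 0 <= s -> s <= t -> t <= T -> `|F t - F s| <= M * (t - s)) ->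
  {within `[0, T], continuous F}.
Proof.
move=> M0 FM.
have FM' s t : 0 <= s <= T -> 0 <= t <= T -> `|F t - F s| <= M * `|t - s|.
  move=> /andP[s0 sT] /andP[t0 tT]; have [st|ts] := leP s t.
    by rewrite [X in _ * X]ger0_norm ?subr_ge0//; exact: FM.
  rewrite distrC (distrC t) [X in _ * X]ger0_norm ?subr_ge0 ?(ltW ts)//.
  by apply: FM => //; exact: ltW.
apply/subspace_continuousP => x /=; rewrite in_itv/= => xT.
apply/cvgrPdist_le => e e0; rewrite near_withinE.
have M1 : 0 < M + 1 by rewrite ltr_wpDl.
apply/nbhs_ballP; exists (e / (M + 1)); first by rewrite /= divr_gt0.
move=> y; rewrite /ball/= ltr_pdivlMr// => xy; rewrite in_itv/= => yT.
apply: le_trans (FM' _ _ yT xT) _; apply: le_trans (ltW xy).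
by rewrite mulrC ler_wpM2l// lerDl.
Qed.

Lemma primitive_measurable F f : primitive F f -> measurable_fun `[0, T] F.
Proof.
move=> /primitive_lip[M M0 /(lipschitz_within_continuous M0) cF].
exact: subspace_continuous_measurable_fun.
Qed.

Lemma primitive_bounded F f : primitive F f ->
  exists M : R, forall t, 0 <= t <= T -> `|F t| <= M.
Proof.
move=> /primitive_lip[M M0 FM]; exists (`|F 0| + M * `|T|) => t /andP[t0 tT].
rewrite -[F t](subrK (F 0)) addrC (le_trans (ler_normD _ _))// lerD2l.
apply: le_trans (FM _ _ _ t0 tT) _ => //; rewrite subr0 ler_wpM2l//.
by rewrite (le_trans tT)// ler_norm.
Qed.

(** A function whose increments are quadratically small is constant: cut
    [[0, t]] into [N] equal pieces. *)
Lemma quadratic_increments_cst (H : R -> R) (C t : R) : 0 <= t ->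
  (forall r s, 0 <= r -> r <= s -> s <= t -> `|H s - H r| <= C * (s - r) ^+ 2) ->
  H t = H 0.
Proof.
move=> t0 HC; apply/eqP; rewrite -subr_eq0 -normr_le0.
apply/ler_addgt0Pr => e e0; rewrite add0r.
pose D := `|C| * t ^+ 2 / e.
have [N ND] : exists N : nat, D <= N.+1%:R.
  have D0 : 0 <= D by rewrite !mulr_ge0 ?invr_ge0 ?(ltW e0)//; exact: sqr_ge0.
  exists (Num.trunc D); exact/ltW/truncnS_gt.
pose p (i : nat) : R := i%:R * (t / N.+1%:R).
have p0 i : 0 <= p i by rewrite mulr_ge0// divr_ge0.
have pS i : p i <= p i.+1 by rewrite ler_wpM2r ?divr_ge0// ler_nat.
have pt i : (i <= N.+1)%N -> p i <= t.
  by move=> iN; rewrite /p mulrCA ler_piMr// ler_pdivrMr// mul1r ler_nat.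
have pN : p N.+1 = t by rewrite /p mulrCA divff ?mulr1// pnatr_eq0.
have -> : H t - H 0 = \sum_(0 <= i < N.+1) (H (p i.+1) - H (p i)).
  by rewrite telescope_sumr// pN /p mul0r.
apply: le_trans (ler_norm_sum _ _ _) _.
apply: (@le_trans _ _ (\sum_(0 <= i < N.+1) C * (t / N.+1%:R) ^+ 2)).
  rewrite !big_mkord; apply: ler_sum => i _.
  have -> : t / N.+1%:R = p i.+1 - p i by rewrite /p -natr1; ring.
  by apply: HC => //; exact: pt.
rewrite sumr_const_nat subn0 -[leLHS]mulr_natr.
apply: (@le_trans _ _ (`|C| * t ^+ 2 / N.+1%:R)).
  have -> : C * (t / N.+1%:R) ^+ 2 * N.+1%:R = C * (t ^+ 2 / N.+1%:R).
    by field; rewrite nat1r pnatr_eq0.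
  rewrite -mulrA ler_wpM2r ?ler_norm// divr_ge0//; exact: sqr_ge0.
by rewrite ler_pdivrMr// -ler_pdivrMl// mulrC.
Qed.

(** The densities are only measurable, so nothing can be differentiated at a
    given time; instead, [F * G] minus the expected primitive has quadratically
    small increments. *)
Lemma primitiveM F f G g : primitive F f -> primitive G g ->
  primitive (fun t => F t * G t) (fun t => f t * G t + F t * g t).
Proof.
move=> PF PG.
have [mf [Mf fM] _] := PF; have [mg [Mg gM] _] := PG.
have mF := primitive_measurable PF; have mG := primitive_measurable PG.
have [BF FB] := primitive_bounded PF; have [BG GB] := primitive_bounded PG.
pose k t := f t * G t + F t * g t.
have mk : measurable_fun `[0, T] k by apply: measurable_funD; exact: measurable_funM.
have bk : exists M : R, forall t, 0 <= t <= T -> `|k t| <= M.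
  exists (Mf * BG + BF * Mg) => t tT; rewrite (le_trans (ler_normD _ _))// !normrM.
  by rewrite lerD// ler_pM// ?fM ?GB ?FB ?gM.
split => // t /andP[t0 tT].
have PK := primitive_integral mk bk.
pose K t := \int[mu]_(s in `[0, t]) k s.
rewrite -/k -[\int[mu]_(s in _) _]/(K t).
have K0 : K 0 = 0 by rewrite /K set_itv1 Rintegral_set1.
have [LF LF0 FL] := primitive_lip PF; have [LG LG0 GL] := primitive_lip PG.
suff : F t * G t - K t = F 0 * G 0 - K 0 by rewrite K0 subr0; lra.
pose H t := F t * G t - K t.
apply: (@quadratic_increments_cst H (Mf * LG + LF * Mg)) => // r s r0 rs st.
have sT : s <= T by rewrite (le_trans st).
(* Freezing the two factors turns the product into a primitive to which the
   integral can be compared. *)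
have PL := primitiveD (primitiveZ (G s) PF) (primitiveZ (F r) PG).
have PU := primitiveZ ((Mf * LG + LF * Mg) * (s - r)) primitive_id.
have PUN := primitiveZ (- ((Mf * LG + LF * Mg) * (s - r))) primitive_id.
have bnd q : r <= q <= s ->
    `|G s * f q + F r * g q - k q| <= (Mf * LG + LF * Mg) * (s - r).
  move=> /andP[rq qs].
  have qT : 0 <= q <= T by rewrite (le_trans r0)//= (le_trans qs).
  have -> : G s * f q + F r * g q - k q = f q * (G s - G q) - (F q - F r) * g q.
    by rewrite /k; ring.
  apply: le_trans (ler_normB _ _) _; rewrite !normrM mulrDl lerD//.
    rewrite -mulrA ler_pM ?fM//; apply: le_trans (GL _ _ _ qs sT) _; first by rewrite (le_trans r0).
    by rewrite ler_wpM2l// lerD2l lerN2.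
  rewrite mulrAC ler_pM ?gM//; apply: le_trans (FL _ _ r0 rq _) _; first by rewrite (le_trans qs).
  by rewrite ler_wpM2l// lerD2r.
have h1 := le_primitive PL (primitiveD PK PU) r0 rs sT.
have h2 := le_primitive (primitiveD PK PUN) PL r0 rs sT.
rewrite /= -/(K s) -/(K r) in h1 h2.
have {}h1 : (G s * F s + F r * G s) - (G s * F r + F r * G r) <=
    K s + (Mf * LG + LF * Mg) * (s - r) * s - (K r + (Mf * LG + LF * Mg) * (s - r) * r).
  by apply: h1 => q /bnd; rewrite ler_norml mulr1 => /andP[_ ?]; lra.
have {}h2 : K s + - ((Mf * LG + LF * Mg) * (s - r)) * s -
    (K r + - ((Mf * LG + LF * Mg) * (s - r)) * r) <=
    (G s * F s + F r * G s) - (G s * F r + F r * G r).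
  by apply: h2 => q /bnd; rewrite ler_norml mulr1 => /andP[? _]; lra.
rewrite /H expr2 ler_norml; apply/andP; split; lra.
Qed.

End primitives.
(** * Estimates for vector-valued primitives *)

Section row_primitives.
Context {R : realType} {n : nat}.
Local Notation Rn := 'rV[R]_n.
Variable T : R.
Implicit Types (V W v w : R -> Rn) (a da : R -> R).

Definition row_primitive V v :=
  forall i, primitive T (fun t => V t 0 i) (fun t => v t 0 i).

Lemma eq_row_primitive V v W w : row_primitive V v ->
  (forall t, 0 <= t <= T -> V t = W t) -> (forall t, 0 <= t <= T -> v t = w t) ->
  row_primitive W w.
Proof.
move=> PV VW vw i; apply: eq_primitive (PV i) _ _ => t tT; first by rewrite VW.
by rewrite vw.
Qed.

Lemma row_primitiveD V v W w : row_primitive V v -> row_primitive W w ->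
  row_primitive (fun t => V t + W t) (fun t => v t + w t).
Proof.
move=> PV PW i; apply: eq_primitive (primitiveD (PV i) (PW i)) _ _ => t _.
  by rewrite rvE.
by rewrite rvE.
Qed.

Lemma row_primitiveZ a da V v : primitive T a da -> row_primitive V v ->
  row_primitive (fun t => a t *: V t) (fun t => da t *: V t + a t *: v t).
Proof.
move=> Pa PV i; apply: eq_primitive (primitiveM Pa (PV i)) _ _ => t _.
  by rewrite rvE.
by rewrite !rvE.
Qed.

Lemma row_primitive_cst (c : Rn) : row_primitive (fun=> c) (fun=> 0).
Proof.
by move=> i; apply: eq_primitive (primitive_cst T (c 0 i)) _ _ => // t _; rewrite rvE.
Qed.

Lemma primitive_sum m (F f : 'I_m -> R -> R) :
  (forall j, primitive T (F j) (f j)) ->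
  primitive T (fun t => \sum_j F j t) (fun t => \sum_j f j t).
Proof.
elim: m F f => [|m IH] F f PF.
  by apply: eq_primitive (primitive_cst T 0) _ _ => t _; rewrite big_ord0.
apply: eq_primitive (primitiveD (PF ord0) (IH _ _ (fun j => PF (lift ord0 j)))) _ _.
  by move=> t _; rewrite big_ord_recl.
by move=> t _; rewrite big_ord_recl.
Qed.

Lemma primitive_mul_col V v (k : 'cV[R]_n) : row_primitive V v ->
  primitive T (fun t => (V t *m k) 0 0) (fun t => (v t *m k) 0 0).
Proof.
move=> PV.
apply: eq_primitive (primitive_sum (fun j => primitiveZ (k j 0) (PV j))) _ _ => t _.
  by rewrite mxE; apply: eq_bigr => j _; rewrite mulrC.
by rewrite mxE; apply: eq_bigr => j _; rewrite mulrC.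
Qed.

Lemma row_primitive_mulmx V v (A : 'M[R]_n) : row_primitive V v ->
  row_primitive (fun t => V t *m A) (fun t => v t *m A).
Proof.
move=> PV i.
apply: eq_primitive (primitive_mul_col (col i A) PV) _ _ => t _.
  by rewrite !mxE; apply: eq_bigr => j _; rewrite mxE.
by rewrite !mxE; apply: eq_bigr => j _; rewrite mxE.
Qed.

Lemma row_primitive_norm_le V v (G g : R -> R) s t : row_primitive V v ->
  primitive T G g -> 0 <= s -> s <= t -> t <= T ->
  (forall r, s <= r <= t -> `|v r| <= g r) -> `|V t - V s| <= G t - G s.
Proof.
move=> PV PG s0 st tT vg.
have PNG := primitiveZ (-1) PG.
have vgi i r : s <= r <= t -> - g r <= v r 0 i <= g r.
  by move=> /vg vgr; rewrite -ler_norml (le_trans (coord_le_norm _ _)).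
have G0 : 0 <= G t - G s.
  have h := le_primitive (primitive_cst T 0) PG s0 st tT.
  rewrite -(subrr (0 : R)); apply: h => r /vg; exact: le_trans.
apply: norm_le_coord => // i.
have h1 := le_primitive (PV i) PG s0 st tT (fun r rr => proj2 (andP (vgi i r rr))).
have vgN r : s <= r <= t -> -1 * g r <= v r 0 i by move=> /(vgi i) /andP[]; rewrite mulN1r.
have h2 := le_primitive PNG (PV i) s0 st tT vgN.
by rewrite !rvE ler_norml; apply/andP; split; lra.
Qed.

Lemma row_primitive_lip V v : row_primitive V v ->
  exists2 M : R, 0 <= M & forall s t, 0 <= s -> s <= t -> t <= T ->
    `|V t - V s| <= M * (t - s).
Proof.
move=> PV.
have H i : exists M : R, 0 <= M /\ forall s t, 0 <= s -> s <= t -> t <= T ->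
    `|V t 0 i - V s 0 i| <= M * (t - s).
  by have [M M0 VM] := primitive_lip (PV i); exists M.
have [M hM] := choice H.
have M0 i : 0 <= M i by case: (hM i).
exists (\sum_i M i) => [|s t s0 st tT]; first exact: sumr_ge0.
apply: norm_le_coord => [|i]; first by rewrite mulr_ge0 ?subr_ge0// sumr_ge0.
rewrite !rvE; apply: le_trans ((hM i).2 _ _ s0 st tT) _.
by rewrite ler_wpM2r ?subr_ge0// (bigD1 i)//= lerDl sumr_ge0.
Qed.

Lemma row_primitive_max V v : 0 <= T -> row_primitive V v ->
  exists2 t, 0 <= t <= T & forall s, 0 <= s <= T -> `|V s| <= `|V t|.
Proof.
move=> T0 /row_primitive_lip[M M0 VM].
have cV : {within `[0, T], continuous (fun t => `|V t|)}.
  apply: (@lipschitz_within_continuous _ _ _ M) => // s t s0 st tT.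
  by apply: le_trans (ler_dist_dist _ _) _; exact: VM.
have [t tT tmax] := EVT_max T0 cV.
by exists t => [|s sT]; [move: tT; rewrite in_itv | apply: tmax; rewrite in_itv].
Qed.

Lemma col_bounded (k : 'cV[R]_n) :
  exists2 K : R, 0 <= K & forall x : Rn, `|(x *m k) 0 0| <= K * `|x|.
Proof.
exists (\sum_i `|k i 0|) => [|x]; first exact: sumr_ge0.
rewrite mxE; apply: le_trans (ler_norm_sum _ _ _) _.
rewrite mulr_suml; apply: ler_sum => i _; rewrite normrM mulrC.
by rewrite ler_wpM2l// coord_le_norm.
Qed.

End row_primitives.

Section energy.
Context {R : realType}.
Variable T : R.

(** [I] and [E] are the integrals of [|y|] and [y ^+ 2] over [[0, T]]; they
    are used only through the comparisons below. *)
Record energy (y : R -> R) (I E : R) : Prop := Energy {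
  energy_I_ge0 : 0 <= I ;
  energy_E_ge0 : 0 <= E ;
  energy_cauchy_schwarz : I ^+ 2 <= T * E ;
  energy_I_le : forall N : R, (forall t, 0 <= t <= T -> `|y t| <= N) -> I <= N * T ;
  energy_row : forall n (V v : R -> 'rV[R]_n) (a c e : R),
    row_primitive T V v -> 0 <= a -> 0 <= c -> 0 <= e ->
    (forall t, 0 <= t <= T -> `|v t| <= a * `|y t| + (c * y t ^+ 2 + e)) ->
    forall t, 0 <= t <= T -> `|V t - V 0| <= a * I + (c * E + e * T) ;
  energy_scalar : forall (F f : R -> R) (a c e : R), primitive T F f ->
    (forall t, 0 <= t <= T -> f t <= a * `|y t| + (c * y t ^+ 2 + e)) ->
    F T - F 0 <= a * I + (c * E + e * T) }.

Lemma energy_exists (y dy : R -> R) : 0 < T -> primitive T y dy ->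
  exists I E : R, energy y I E.
Proof.
move=> T_0 Py; have T0 : 0 <= T by exact: ltW.
have my := primitive_measurable Py.
have [N yN] := primitive_bounded Py.
have mny : measurable_fun `[0, T] (fun t => `|y t|) by exact: measurableT_comp.
have my2 : measurable_fun `[0, T] (fun t => y t ^+ 2) by exact: measurable_funX.
have bny : exists N' : R, forall t, 0 <= t <= T -> `| `|y t| | <= N'.
  by exists N => t tT; rewrite normr_id yN.
have by2 : exists N' : R, forall t, 0 <= t <= T -> `|y t ^+ 2| <= N'.
  exists (`|N| ^+ 2) => t tT; rewrite normrX lerXn2r ?nnegrE//.
  by rewrite (le_trans (yN _ tT))// ler_norm.
have PI := primitive_integral mny bny; have PE := primitive_integral my2 by2.
pose IY t := \int[@lebesgue_measure R]_(s in `[0, t]) `|y s|.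
pose EY t := \int[@lebesgue_measure R]_(s in `[0, t]) (y s ^+ 2).
have I0 : IY 0 = 0 by rewrite /IY set_itv1 Rintegral_set1.
have E0 : EY 0 = 0 by rewrite /EY set_itv1 Rintegral_set1.
rewrite -/(IY) in PI; rewrite -/(EY) in PE.
move: (IY) (EY) I0 E0 PI PE => {IY EY} IY EY I0 E0 PI PE {mny my2 bny by2 my}.
have id1 := primitive_id T.
have IE (a c e : R) : primitive T (fun t => a * IY t + (c * EY t + e * t))
    (fun t => a * `|y t| + (c * y t ^+ 2 + e)).
  apply: eq_primitive (primitiveD (primitiveZ a PI) (primitiveD (primitiveZ c PE) (primitiveZ e id1))) _ _ => // t _.
  by rewrite mulr1.
have scal (F f : R -> R) (a c e : R) : primitive T F f ->
    (forall t, 0 <= t <= T -> f t <= a * `|y t| + (c * y t ^+ 2 + e)) ->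
    F T - F 0 <= a * IY T + (c * EY T + e * T).
  move=> PF /(le_primitive PF (IE a c e) (lexx 0) T0 (lexx T)).
  by rewrite I0 E0 !mulr0 !addr0 subr0.
have pos (a c e t : R) : 0 <= a -> 0 <= c -> 0 <= e -> 0 <= a * `|y t| + (c * y t ^+ 2 + e).
  move=> a0 c0 e0; have q1 := mulr_ge0 a0 (normr_ge0 (y t)).
  by have q2 := mulr_ge0 c0 (sqr_ge0 (y t)); rewrite (addr_ge0 q1)// (addr_ge0 q2).
have mono (a c e t : R) : 0 <= a -> 0 <= c -> 0 <= e -> 0 <= t <= T ->
    a * IY t + (c * EY t + e * t) <= a * IY T + (c * EY T + e * T).
  move=> a0 c0 e0 /andP[t0 tT].
  have := le_primitive (primitive_cst T 0) (IE a c e) t0 tT (lexx T).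
  by rewrite subrr subr_ge0; apply => r _; exact: pos.
have TT : 0 <= (0 : R) <= T by apply/andP; split.
have IT0 : 0 <= IY T.
  have := mono 1 0 0 0 ler01 (lexx 0) (lexx 0) TT.
  by rewrite !mul0r !mul1r I0 !addr0.
have ET0 : 0 <= EY T.
  have := mono 0 1 0 0 (lexx 0) ler01 (lexx 0) TT.
  by rewrite !mul0r !mul1r E0 !addr0 !add0r.
exists (IY T), (EY T); split => //.
- pose q := IY T / T.
  have qT : q * T = IY T by rewrite /q divfK// gt_eqF.
  have hh r : 0 <= r <= T -> 2 * q * `|y r| + (0 * y r ^+ 2 + 0) <=
      0 * `|y r| + (1 * y r ^+ 2 + q ^+ 2).
    move=> _; rewrite -(real_normK (num_real (y r))).
    by have := sqr_ge0 (`|y r| - q); rewrite !expr2; lra.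
  have := scal _ _ _ _ _ (IE _ _ _) hh.
  rewrite I0 E0 !mulr0 !mul0r !mul1r !addr0 !add0r !subr0 => h.
  have h' := ler_wpM2l T0 h.
  have e1 : T * (2 * q * IY T) = 2 * IY T ^+ 2 by rewrite -qT; ring.
  have e2 : T * (EY T + q ^+ 2 * T) = T * EY T + IY T ^+ 2 by rewrite -qT; ring.
  by move: h'; rewrite e1 e2; clear; lra.
- move=> N' yN'.
  have hh r : 0 <= r <= T -> 1 * `|y r| + (0 * y r ^+ 2 + 0) <= N' * 1.
    by move=> /yN'; rewrite mul1r mul0r !addr0 mulr1.
  have := le_primitive (IE 1 0 0) (primitiveZ N' id1) (lexx 0) T0 (lexx T) hh.
  by rewrite I0 !mul0r !mulr0 !mul1r !addr0 !subr0.
- move=> n V v a c e PV a0 c0 e0 vb t tT; have /andP[t0 tT'] := tT.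
  have hh r : 0 <= r <= t -> `|v r| <= a * `|y r| + (c * y r ^+ 2 + e).
    by move=> /andP[r0 rt]; apply: vb; rewrite r0 (le_trans rt).
  have := row_primitive_norm_le PV (IE a c e) (lexx 0) t0 tT' hh.
  rewrite I0 E0 !mulr0 !addr0 subr0 => h; apply: le_trans h _; exact: mono.
Qed.

(** Over a short time the linear growth of a state is absorbed by its own
    supremum, so that no exponential is needed. *)
Lemma linear_growth n (y : R -> R) (I E : R) (V v : R -> 'rV[R]_n) (K a c e : R) :
  0 <= T -> energy y I E -> row_primitive T V v -> V 0 = 0 ->
  0 <= K -> 0 <= a -> 0 <= c -> 0 <= e ->
  (forall t, 0 <= t <= T ->
    `|v t| <= K * `|V t| + (a * `|y t| + (c * y t ^+ 2 + e))) ->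
  exists S : R, [/\ 0 <= S, forall t, 0 <= t <= T -> `|V t| <= S &
    S <= a * I + (c * E + (K * S + e) * T)].
Proof.
move=> T0 En PV V0 K0 a0 c0 e0 vb.
have [t tT tmax] := row_primitive_max T0 PV.
exists `|V t|; split => //.
have KVe : 0 <= K * `|V t| + e by rewrite addr_ge0// mulr_ge0.
rewrite -(subr0 (V t)) -V0.
apply: (energy_row En PV a0 c0 _ _ tT); rewrite V0 subr0// => s sT.
apply: le_trans (vb s sT) _.
have := ler_wpM2l K0 (tmax s sT); clear; lra.
Qed.

End energy.
(** * Straightening the state along the controlled field *)

Section uniform_bounds.
Context {R : realType} {n : nat} {X : Type}.
Local Notation Rn := 'rV[R]_n.
Variables (D : X -> Prop) (g : X -> R).
Hypothesis g0 : forall p, D p -> 0 <= g p.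

(** The constant is uniform in the parameters [p], which will be the values of
    the state and of the controls at an arbitrary time. *)
Definition dominated (F : X -> Rn) :=
  exists2 K : R, 0 <= K & forall p, D p -> `|F p| <= K * g p.

Lemma dominatedD F G : dominated F -> dominated G ->
  dominated (fun p => F p + G p).
Proof.
move=> [K K0 FK] [L L0 GL]; exists (K + L) => [|p Dp]; first exact: addr_ge0.
by rewrite (le_trans (ler_normD _ _))// mulrDl lerD ?FK ?GL.
Qed.

Lemma dominatedB F G : dominated F -> dominated G ->
  dominated (fun p => F p - G p).
Proof.
move=> dF [L L0 GL]; apply: dominatedD dF _.
by exists L => // p Dp; rewrite normrN GL.
Qed.

Lemma dominatedZ (a : X -> R) (L : R) F : (forall p, D p -> `|a p| <= L) ->
  dominated F -> dominated (fun p => a p *: F p).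
Proof.
move=> aL [K K0 FK]; exists (`|L| * K) => [|p Dp]; first exact: mulr_ge0.
rewrite normrZ -mulrA ler_pM// ?FK//.
by rewrite (le_trans (aL _ Dp))// ler_norm.
Qed.

Lemma dominated_mulmx (A : 'M[R]_n) F : dominated F ->
  dominated (fun p => F p *m A).
Proof.
move=> [K K0 FK]; have [L L0 hL] := mulmx_bounded A.
exists (L * K) => [|p Dp]; first exact: mulr_ge0.
by rewrite (le_trans (hL _))// -mulrA ler_wpM2l// FK.
Qed.

End uniform_bounds.

Section remainder.
Context {R : realType} {n : nat}.
Local Notation Rn := 'rV[R]_n.
Variables (f0 f1 f2 : Rn -> Rn) (A0 A1 A2 : 'M[R]_n).
Variables (Q0 Q1 Q2 : 'I_n -> 'M[R]_n) (C rho M : R) (b : Rn).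
Hypotheses (rho0 : 0 < rho) (C0 : 0 <= C) (M0 : 0 <= M).
Hypotheses (J0 : has_jet f0 0 A0 Q0 C rho) (J1 : has_jet f1 0 A1 Q1 C rho)
  (J2 : has_jet f2 0 A2 Q2 C rho).
Hypotheses (f00 : f0 0 = 0) (f10 : f1 0 = b) (f20 : f2 0 = 0).

Definition velocity (u1 u2 : R) (z : Rn) := f0 z + u1 *: f1 z + u2 *: f2 z.

(** The value at 0 of the bracket of [f1] with [[f, f1]], for [f] vanishing at 0
    with jet [(A, Q)]: see [second_bracket_at0]. *)
Definition bracket2 (A : 'M[R]_n) (Q : 'I_n -> 'M[R]_n) : Rn :=
  2 *: (b *m A *m A1) - b *m A1 *m A - 2 *: qform Q b b.

(** Chosen so that the derivative of [y ^+ 3 *: cubic] cancels the terms in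
    [u1 * y ^+ 2]. *)
Definition cubic : Rn := 3^-1 *: (qform Q1 b b - b *m A1 *m A1).

(** [y *: b] plus the flow of [- f1] for the time [y] applied to the state
    [y *: b + xi], truncated. Its derivative contains no term in [u1] up to the
    order considered, apart from [u1 *: b]. *)
Definition straightened (y : R) (xi : Rn) : Rn :=
  y *: b + xi - (y ^+ 2 / 2) *: (b *m A1) - y *: (xi *m A1) - y ^+ 3 *: cubic.

(** The time derivative of [straightened] along the controlled system, where [y]
    has derivative [u1]. *)
Definition dstraightened (y u1 u2 : R) (xi : Rn) : Rn :=
  velocity u1 u2 (y *: b + xi) - (u1 * y) *: (b *m A1)
  - (u1 *: (xi *m A1) + y *: ((velocity u1 u2 (y *: b + xi) - u1 *: b) *m A1))
  - (3 * u1 * y ^+ 2) *: cubic.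

(** What is left of the derivative besides the linear dynamics, the motion along
    [b] and the quadratic drift. *)
Definition remainder (y u1 u2 : R) (xi : Rn) : Rn :=
  dstraightened y u1 u2 xi -
  (u1 *: b + straightened y xi *m A0 + u2 *: (straightened y xi *m A2)
   - (y ^+ 2 / 2) *: (bracket2 A0 Q0 + u2 *: bracket2 A2 Q2)).

(** The terms in [y ^+ 2] cancel by the formula for the brackets, those in
    [u1 * y] and [u1 *: xi] by the choice of [straightened], and those in
    [u1 * y ^+ 2] by that of [cubic]. *)
Lemma remainderE y u1 u2 xi : let z := y *: b + xi in
  let dq Q := y *: qform Q b xi + y *: qform Q xi b + qform Q xi xi in
  let s f A Q := qform Q z z + jet_rem f 0 A Q z in
  remainder y u1 u2 xi =
    (dq Q0 + u1 *: dq Q1 + u2 *: dq Q2)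
  + (jet_rem f0 0 A0 Q0 z + u1 *: jet_rem f1 0 A1 Q1 z + u2 *: jet_rem f2 0 A2 Q2 z)
  + (y *: xi *m A1 *m A0 + u2 *: (y *: xi *m A1 *m A2))
  + (y ^+ 3 *: cubic *m A0 + u2 *: (y ^+ 3 *: cubic *m A2))
  - (y *: xi *m A0 *m A1 + u1 *: (y *: xi *m A1 *m A1) + u2 *: (y *: xi *m A2 *m A1))
  - (y *: s f0 A0 Q0 + u1 *: (y *: s f1 A1 Q1) + u2 *: (y *: s f2 A2 Q2)) *m A1.
Proof.
move=> z dq s.
have e0 := jet_expand f0 A0 Q0 0 z; rewrite add0r f00 add0r in e0.
have e1 := jet_expand f1 A1 Q1 0 z; rewrite add0r f10 in e1.
have e2 := jet_expand f2 A2 Q2 0 z; rewrite add0r f20 add0r in e2.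
rewrite /remainder /dstraightened /velocity -/z e0 e1 e2 /s.
move: (jet_rem f0 0 A0 Q0 z) (jet_rem f1 0 A1 Q1 z) (jet_rem f2 0 A2 Q2 z) => r0 r1 r2.
have qz Q : qform Q z z = y ^+ 2 *: qform Q b b + dq Q.
  rewrite /z /dq qformDl !qformDr !qformZl !qformZr.
  by apply/rowP => i; rewrite !rvE; ring.
rewrite !qz /straightened -/z.
have zA A : z *m A = y *: (b *m A) + xi *m A by rewrite mulmxDl -scalemxAl.
have cE : qform Q1 b b = 3 *: cubic + b *m A1 *m A1.
  by rewrite /cubic scalerA divff ?pnatr_eq0// scale1r subrK.
rewrite /bracket2 cE.
move: cubic (dq Q0) (dq Q1) (dq Q2) => c d0 d1 d2.
rewrite !(mulmxDl, mulNmx, zA, =^~ scalemxAl).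
by apply/rowP => i; rewrite !rvE; field.
Qed.

(** Every term of [remainderE] contains [xi] twice, or [y] and [xi], or is of
    order 3 with a factor of size [tau], the length of the time interval. *)
Lemma remainder_bound : exists2 K : R, 0 <= K &
  forall (y u1 u2 tau : R) (xi : Rn), `|u1| <= M -> `|u2| <= M ->
    0 <= tau <= 1 -> `|y| <= M * tau -> `|xi| <= M * tau ->
    `|y *: b + xi| <= rho ->
    `|remainder y u1 u2 xi| <= K * (`|y| * `|xi| + `|xi| ^+ 2 + tau * y ^+ 2).
Proof.
pose X := (R * R * R * R * Rn)%type.
pose y (p : X) := p.1.1.1.1; pose u1 (p : X) := p.1.1.1.2.
pose u2 (p : X) := p.1.1.2; pose tau (p : X) := p.1.2; pose xi (p : X) := p.2.
pose z p := y p *: b + xi p.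
pose D p := [/\ `|u1 p| <= M, `|u2 p| <= M, 0 <= tau p <= 1,
  `|y p| <= M * tau p & `|xi p| <= M * tau p] /\ `|z p| <= rho.
pose g p := `|y p| * `|xi p| + `|xi p| ^+ 2 + tau p * y p ^+ 2.
suff : dominated D g (fun p => remainder (y p) (u1 p) (u2 p) (xi p)).
  move=> [K K0 hK]; exists K => // y' u1' u2' tau' xi' h1 h2 h3 h4 h5 h6.
  by apply: (hK (y', u1', u2', tau', xi')).
have gt p : D p -> [/\ 0 <= `|y p| * `|xi p|, 0 <= `|xi p| ^+ 2 & 0 <= tau p * y p ^+ 2].
  move=> [[_ _ /andP[t0 _] _ _] _]; split; [exact: mulr_ge0|exact: sqr_ge0|].
  by apply: mulr_ge0 => //; exact: sqr_ge0.
have u1M p : D p -> `|u1 p| <= M by case => [[]].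
have u2M p : D p -> `|u2 p| <= M by case => [[]].
have yM p : D p -> `|y p| <= M.
  by move=> [[_ _ /andP[t0 t1] h _] _]; rewrite (le_trans h)// ler_piMr.
have xi_dom : dominated D g (fun p => y p *: xi p).
  by exists 1 => // p /gt[? ? ?]; rewrite mul1r normrZ /g; lra.
have yqf_dom Q : dominated D g (fun p => y p *: qform Q b (xi p)).
  have [K K0 hK] := qform_bounded Q; have [L L0 hL] := xi_dom.
  exists (K * `|b| * L) => [|p Dp]; first by rewrite !mulr_ge0.
  rewrite -qformZr (le_trans (hK _ _))// -[leRHS]mulrA; apply: ler_wpM2l; [exact: mulr_ge0|exact: hL].
have yqf_dom' Q : dominated D g (fun p => y p *: qform Q (xi p) b).
  have [K K0 hK] := qform_bounded Q; have [L L0 hL] := xi_dom.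
  exists (K * L * `|b|) => [|p Dp]; first by rewrite !mulr_ge0.
  rewrite -qformZl (le_trans (hK _ _))// [leRHS]mulrAC; apply: ler_wpM2r => //.
  by rewrite -[leRHS]mulrA; apply: ler_wpM2l => //; exact: hL.
have qf_dom Q : dominated D g (fun p => qform Q (xi p) (xi p)).
  have [K K0 hK] := qform_bounded Q.
  exists K => // p /gt[? ? ?]; rewrite (le_trans (hK _ _))//.
  by rewrite -mulrA ler_wpM2l// -expr2 /g; lra.
have y3_dom (c : Rn) : dominated D g (fun p => y p ^+ 3 *: c).
  exists (M * `|c|) => [|p Dp]; first exact: mulr_ge0.
  have [? ? ?] := gt _ Dp; have [[_ _ /andP[t0 _] yt _] _] := Dp.
  rewrite normrZ normrX exprS -normrX (ger0_norm (sqr_ge0 _)).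
  have h : `|y p| * y p ^+ 2 <= M * (tau p * y p ^+ 2).
    by rewrite mulrA ler_wpM2r// sqr_ge0.
  apply: (@le_trans _ _ (M * (tau p * y p ^+ 2) * `|c|)); first by rewrite ler_wpM2r.
  by rewrite mulrAC; apply: ler_wpM2l; [exact: mulr_ge0|rewrite /g; lra].
(* |z|^2 is of order y^2 + |xi|^2, and every extra factor y or z brings a tau. *)
pose B := `|b|; have B0 : 0 <= B := normr_ge0 _.
have B1 : 0 <= B + 1 by rewrite addr_ge0.
have B2 : 0 <= B ^+ 2 + 1 by rewrite addr_ge0// sqr_ge0.
have zsq p : `|z p| ^+ 2 <= 2 * (B ^+ 2 * y p ^+ 2 + `|xi p| ^+ 2).
  have : `|z p| <= `|y p| * B + `|xi p| by rewrite /z (le_trans (ler_normD _ _))// normrZ.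
  have := normr_ge0 (z p); have := normr_ge0 (xi p); have := mulr_ge0 (normr_ge0 (y p)) (normr_ge0 b).
  rewrite -/B -(real_normK (num_real (y p))) => h1 h2 h3 h4.
  have h5 : `|z p| ^+ 2 <= (`|y p| * B + `|xi p|) ^+ 2 by rewrite lerXn2r// ?nnegrE// addr_ge0.
  have := sqr_ge0 (`|y p| * B - `|xi p|); nra.
have tz p (a : R) : D p -> 0 <= a -> a <= tau p ->
    a * `|z p| ^+ 2 <= 2 * (B ^+ 2 + 1) * g p.
  move=> [[_ _ /andP[t0 t1] _ _] _] a0 at_.
  have B20 : 0 <= B ^+ 2 := sqr_ge0 _.
  have xi0 : 0 <= `|xi p| ^+ 2 := sqr_ge0 _.
  have y0 : 0 <= y p ^+ 2 := sqr_ge0 _.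
  have yx0 : 0 <= `|y p| * `|xi p| by rewrite mulr_ge0.
  have h1 : a * `|z p| ^+ 2 <= tau p * (2 * (B ^+ 2 * y p ^+ 2 + `|xi p| ^+ 2)).
    by rewrite ler_pM// ?sqr_ge0.
  have h2 : tau p * `|xi p| ^+ 2 <= `|xi p| ^+ 2 by rewrite ler_piMl.
  have h3 : 0 <= tau p * y p ^+ 2 by rewrite mulr_ge0.
  have h4 := mulr_ge0 B20 yx0; have h5 := mulr_ge0 B20 xi0.
  rewrite /g; nra.
have yq_dom Q : dominated D g (fun p => y p *: qform Q (z p) (z p)).
  have [K K0 hK] := qform_bounded Q.
  exists (K * (M * (2 * (B ^+ 2 + 1)))) => [|p Dp].
    by rewrite !mulr_ge0.
  have [[_ _ /andP[t0 t1] yt _] _] := Dp.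
  have h := tz p (tau p) Dp t0 (lexx _).
  rewrite normrZ (le_trans (ler_wpM2l _ (hK _ _)))// -(mulrA K) -expr2.
  rewrite mulrCA -(mulrA K) ler_wpM2l// -(mulrA M).
  apply: (@le_trans _ _ (M * tau p * `|z p| ^+ 2)); first by rewrite ler_wpM2r// sqr_ge0.
  by rewrite -(mulrA M) ler_wpM2l.
have r_dom f A Q : has_jet f 0 A Q C rho -> dominated D g (fun p => jet_rem f 0 A Q (z p)).
  move=> J; exists (C * (M * (B + 1) * (2 * (B ^+ 2 + 1)))) => [|p Dp].
    by rewrite !mulr_ge0.
  have [[_ _ /andP[t0 t1] yt xt] zr] := Dp.
  have h := tz p (tau p) Dp t0 (lexx _).
  rewrite (le_trans (jet_rem_le J zr))// -(mulrA C) ler_wpM2l//.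
  have zt : `|z p| <= M * (B + 1) * tau p.
    have : `|z p| <= `|y p| * B + `|xi p| by rewrite /z (le_trans (ler_normD _ _))// normrZ.
    have := ler_wpM2r B0 yt; lra.
  rewrite exprS -(mulrA (M * (B + 1))).
  apply: (@le_trans _ _ (M * (B + 1) * tau p * `|z p| ^+ 2)); first by rewrite ler_wpM2r// sqr_ge0.
  by rewrite -(mulrA (M * (B + 1))) ler_wpM2l// mulr_ge0.
have [K K0 hK] : dominated D g (fun p : X =>
    let dq Q := y p *: qform Q b (xi p) + y p *: qform Q (xi p) b + qform Q (xi p) (xi p) in
    let s f A Q := qform Q (z p) (z p) + jet_rem f 0 A Q (z p) in
    (dq Q0 + u1 p *: dq Q1 + u2 p *: dq Q2)
  + (jet_rem f0 0 A0 Q0 (z p) + u1 p *: jet_rem f1 0 A1 Q1 (z p) + u2 p *: jet_rem f2 0 A2 Q2 (z p))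
  + (y p *: xi p *m A1 *m A0 + u2 p *: (y p *: xi p *m A1 *m A2))
  + (y p ^+ 3 *: cubic *m A0 + u2 p *: (y p ^+ 3 *: cubic *m A2))
  - (y p *: xi p *m A0 *m A1 + u1 p *: (y p *: xi p *m A1 *m A1) + u2 p *: (y p *: xi p *m A2 *m A1))
  - (y p *: s f0 A0 Q0 + u1 p *: (y p *: s f1 A1 Q1) + u2 p *: (y p *: s f2 A2 Q2)) *m A1).
  rewrite /=.
  have dq_dom Q : dominated D g (fun p => y p *: qform Q b (xi p) + y p *: qform Q (xi p) b + qform Q (xi p) (xi p)).
    by apply: dominatedD => //; exact: dominatedD.
  have s_dom f A Q : has_jet f 0 A Q C rho ->
      dominated D g (fun p => y p *: (qform Q (z p) (z p) + jet_rem f 0 A Q (z p))).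
    move=> J; have [L L0 hL] := dominatedD (yq_dom Q) (dominatedZ yM (r_dom _ _ _ J)).
    by exists L => // p Dp; rewrite scalerDr hL.
  have c3 (F0 F1 F2 : X -> Rn) : dominated D g F0 -> dominated D g F1 -> dominated D g F2 ->
      dominated D g (fun p => F0 p + u1 p *: F1 p + u2 p *: F2 p).
    move=> d0 d1 d2.
    exact: (dominatedD (dominatedD d0 (dominatedZ u1M d1)) (dominatedZ u2M d2)).
  have c2 (F0 F2 : X -> Rn) : dominated D g F0 -> dominated D g F2 ->
      dominated D g (fun p => F0 p + u2 p *: F2 p).
    by move=> d0 d2; exact: (dominatedD d0 (dominatedZ u2M d2)).
  have xiA (A A' : 'M[R]_n) : dominated D g (fun p => y p *: xi p *m A *m A').
    exact: (@dominated_mulmx _ _ _ D g A' (fun p => y p *: xi p *m A) (@dominated_mulmx _ _ _ D g A (fun p => y p *: xi p) xi_dom)).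
  have y3A (A : 'M[R]_n) : dominated D g (fun p => y p ^+ 3 *: cubic *m A).
    exact: (@dominated_mulmx _ _ _ D g A (fun p => y p ^+ 3 *: cubic) (y3_dom cubic)).
  have h1 := c3 _ _ _ (dq_dom Q0) (dq_dom Q1) (dq_dom Q2).
  have h2 := c3 _ _ _ (r_dom _ _ _ J0) (r_dom _ _ _ J1) (r_dom _ _ _ J2).
  have h3 := c2 _ _ (xiA A1 A0) (xiA A1 A2).
  have h4 := c2 _ _ (y3A A0) (y3A A2).
  have h5 := c3 _ _ _ (xiA A0 A1) (xiA A1 A1) (xiA A2 A1).
  have h6 := c3 _ _ _ (s_dom _ _ _ J0) (s_dom _ _ _ J1) (s_dom _ _ _ J2).
  have h7 := @dominated_mulmx _ _ _ _ _ A1 _ h6.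
  exact: (dominatedB (dominatedB (dominatedD (dominatedD (dominatedD h1 h2) h3) h4) h5) h7).
exists K => // p Dp; rewrite remainderE; exact: hK.
Qed.

Lemma jet_growth f A Q : has_jet f 0 A Q C rho ->
  exists2 L : R, 0 <= L & forall z : Rn, `|z| <= rho -> `|f z - f 0| <= L * `|z|.
Proof.
move=> J; have [K K0 hK] := mulmx_bounded A; have [L L0 hL] := qform_bounded Q.
exists (K + L * rho + C * rho ^+ 2) => [|z zr].
  by rewrite !addr_ge0// mulr_ge0// ?sqr_ge0// ltW.
have e := jet_expand f A Q 0 z; rewrite add0r in e.
have -> : f z - f 0 = z *m A + qform Q z z + jet_rem f 0 A Q z.
  by rewrite e; apply/rowP => i; rewrite !rvE; ring.
apply: le_trans (ler_normD _ _) _; rewrite 2!mulrDl; apply: lerD.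
  apply: le_trans (ler_normD _ _) _; apply: lerD; first exact: hK.
  by apply: le_trans (hL _ _) _; rewrite ler_wpM2r// ler_wpM2l.
apply: le_trans (jet_rem_le J zr) _; rewrite exprSr mulrA ler_wpM2r// ler_wpM2l//.
by rewrite lerXn2r// nnegrE// ltW.
Qed.

Lemma drift_growth : exists2 L : R, 0 <= L &
  forall (u1 u2 : R) (z : Rn), `|u1| <= M -> `|u2| <= M -> `|z| <= rho ->
    `|velocity u1 u2 z - u1 *: b| <= L * `|z|.
Proof.
have [L0 L00 h0] := jet_growth J0; have [L1 L10 h1] := jet_growth J1.
have [L2 L20 h2] := jet_growth J2.
exists (L0 + M * L1 + M * L2) => [|u1 u2 z u1M u2M zr].
  by rewrite !addr_ge0// mulr_ge0.
have -> : velocity u1 u2 z - u1 *: b =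
    (f0 z - f0 0) + u1 *: (f1 z - f1 0) + u2 *: (f2 z - f2 0).
  rewrite /velocity f00 f10 f20.
  by apply/rowP => i; rewrite !rvE; ring.
apply: le_trans (ler_normD _ _) _; rewrite 2!mulrDl; apply: lerD.
  apply: le_trans (ler_normD _ _) _; apply: lerD; first exact: h0.
  by rewrite normrZ -mulrA ler_pM// h1.
by rewrite normrZ -mulrA ler_pM// h2.
Qed.

Lemma straightened_primitive T (y u1 u2 : R -> R) (z : R -> Rn) :
  primitive T y u1 ->
  row_primitive T z (fun t => velocity (u1 t) (u2 t) (z t)) ->
  let xi t := z t - y t *: b in
  row_primitive T xi (fun t => velocity (u1 t) (u2 t) (z t) - u1 t *: b) /\
  row_primitive T (fun t => straightened (y t) (xi t))
    (fun t => dstraightened (y t) (u1 t) (u2 t) (xi t)).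
Proof.
move=> Py Pz xi.
have Pxi : row_primitive T xi (fun t => velocity (u1 t) (u2 t) (z t) - u1 t *: b).
  apply: eq_row_primitive (row_primitiveD Pz
    (row_primitiveZ (primitiveZ (-1) Py) (row_primitive_cst T b))) _ _ => t _.
    by apply/rowP => i; rewrite /xi !rvE; ring.
  by apply/rowP => i; rewrite !rvE; ring.
split=> //.
have Py2 := primitiveM Py Py; have Py3 := primitiveM Py Py2.
have h2 := row_primitiveZ (primitiveZ (- 2^-1) Py2) (row_primitive_cst T (b *m A1)).
have h3 := row_primitiveZ (primitiveZ (-1) Py) (row_primitive_mulmx A1 Pxi).
have h4 := row_primitiveZ (primitiveZ (-1) Py3) (row_primitive_cst T cubic).
have zE t : y t *: b + xi t = z t by rewrite /xi addrC subrK.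
apply: eq_row_primitive (row_primitiveD (row_primitiveD (row_primitiveD Pz h2) h3) h4) _ _ => t _.
  rewrite /straightened zE; move: (z t) (xi t) cubic (b *m A1) => zt xt c c'.
  by apply/rowP => i; rewrite !rvE; field.
rewrite /dstraightened zE; move: (velocity _ _ _) (xi t) cubic (b *m A1) => v xt c c'.
rewrite !(mulmxDl, mulNmx, =^~ scalemxAl).
move: (v *m A1) (xt *m A1) (b *m A1) => v1 x1 b1.
by apply/rowP => i; rewrite !rvE; field.
Qed.

Lemma straightened0 : straightened 0 0 = 0.
Proof. by rewrite /straightened mul0mx expr0n expr0n /= mul0r !scale0r !subr0 addr0. Qed.

(** The hypotheses are the inequalities satisfied along a trajectory, with [S]
    and [Sw] bounds on [xi] and on the straightened state modulo [R1], [sT] and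
    [zk] the values of the linear form on the final straightened state and on
    the final state. As [S] is of order [I] and [I ^+ 2 <= T * E], all terms of
    the bound on [zk] but [- c0 / 2 * E] are of order [T * E]. *)
Lemma small_time_balance (L1 K2 K3 KR Kk K8 Kl c0 : R) :
  0 <= L1 -> 0 <= K2 -> 0 <= K3 -> 0 <= KR -> 0 <= Kk -> 0 <= K8 -> 0 <= Kl ->
  0 < c0 ->
  exists2 T0 : R, 0 < T0 & forall T S I E Sw sT zk yT : R,
    0 < T -> T <= T0 -> 0 <= S -> 0 <= I -> 0 <= E -> 0 <= Sw ->
    S <= 2 * L1 * I -> I ^+ 2 <= T * E -> S <= M * T ->
    Sw <= K2 * Sw * T + K3 * E + KR * (S * I + S ^+ 2 * T + T * E) ->
    sT <= Kk * (K2 * Sw * T) - c0 / 2 * E + Kk * (KR * (S * I + S ^+ 2 * T + T * E)) ->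
    0 <= yT -> yT <= Kl * S ->
    zk <= sT + K8 * (yT ^+ 2 + yT * S + yT ^+ 3) -> zk <= 0.
Proof.
move=> L10 K20 K30 KR0 Kk0 K80 Kl0 c00.
pose h := 2 * L1 + 4 * L1 ^+ 2 + 1.
pose G := 2 * (K3 + KR * h).
pose D := Kk * K2 * G + Kk * KR * h + K8 * (Kl ^+ 2 + Kl + Kl ^+ 3 * M) * (4 * L1 ^+ 2).
have L12 : 0 <= L1 ^+ 2 := sqr_ge0 _.
have h0 : 0 <= h by rewrite /h !addr_ge0// mulr_ge0.
have G0 : 0 <= G by rewrite mulr_ge0// addr_ge0// mulr_ge0.
have Kl2 : 0 <= Kl ^+ 2 := sqr_ge0 _.
have Kl3 : 0 <= Kl ^+ 3 by rewrite exprn_ge0.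
have Kls : 0 <= Kl ^+ 2 + Kl + Kl ^+ 3 * M by rewrite !addr_ge0// mulr_ge0.
have D0 : 0 <= D.
  apply: addr_ge0; last by rewrite mulr_ge0// mulr_ge0.
  by rewrite addr_ge0// mulr_ge0// mulr_ge0.
exists (Num.min 1 (Num.min (2 * K2 + 1)^-1 (c0 / (2 * D + 1)))).
  by rewrite !lt_min ltr01 invr_gt0 divr_gt0 ?ltr_wpDl ?mulr_ge0.
move=> T S I E Sw sT zk yT T0; rewrite !le_min => /andP[T1 /andP[TK TD]].
move=> S0 I0 E0 Sw0 SI IE SM hSw hs y0 yS hz.
have {}TK : K2 * T <= 2^-1.
  have : T * (2 * K2 + 1) <= 1 by rewrite -ler_pdivlMr ?mul1r// ltr_wpDl ?mulr_ge0.
  lra.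
have {}TD : D * T <= c0 / 2.
  have : T * (2 * D + 1) <= c0 by rewrite -ler_pdivlMr// ltr_wpDl ?mulr_ge0.
  lra.
have TE0 : 0 <= T * E by rewrite mulr_ge0// ltW.
have SI2 : S * I <= 2 * L1 * (T * E).
  have : S * I <= 2 * L1 * I * I by rewrite ler_wpM2r.
  have := ler_wpM2l (mulr_ge0 (ler0n _ 2) L10) IE; rewrite expr2; lra.
have S2 : S ^+ 2 <= 4 * L1 ^+ 2 * (T * E).
  have : S ^+ 2 <= (2 * L1 * I) ^+ 2 by rewrite lerXn2r// nnegrE !mulr_ge0.
  have := ler_wpM2l (mulr_ge0 (ler0n _ 4) L12) IE; rewrite !expr2; lra.
have S20 : 0 <= S ^+ 2 := sqr_ge0 _.
have H : S * I + S ^+ 2 * T + T * E <= h * (T * E).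
  have : S ^+ 2 * T <= S ^+ 2 by rewrite ler_piMr.
  rewrite /h; lra.
have TEE : T * E <= E by rewrite ler_piMl.
have KRH : KR * (S * I + S ^+ 2 * T + T * E) <= KR * h * (T * E).
  by rewrite -mulrA ler_wpM2l.
have SwG : Sw <= G * E.
  have h1 := ler_wpM2r Sw0 TK.
  have h2 := ler_wpM2l (mulr_ge0 KR0 h0) TEE.
  have h3 : K2 * Sw * T = K2 * T * Sw by ring.
  rewrite /G; lra.
have g1 : Kk * (K2 * Sw * T) <= Kk * K2 * G * (T * E).
  have h1 : K2 * T * Sw <= K2 * T * (G * E) by rewrite ler_wpM2l// mulr_ge0// ltW.
  have h2 := ler_wpM2l Kk0 h1; lra.
have g2 : Kk * (KR * (S * I + S ^+ 2 * T + T * E)) <= Kk * KR * h * (T * E).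
  have h2 := ler_wpM2l Kk0 KRH; lra.
have g3 : yT ^+ 2 + yT * S + yT ^+ 3 <= (Kl ^+ 2 + Kl + Kl ^+ 3 * M) * S ^+ 2.
  have h1 : yT ^+ 2 <= Kl ^+ 2 * S ^+ 2 by rewrite -exprMn lerXn2r// nnegrE mulr_ge0.
  have h2 : yT * S <= Kl * S ^+ 2 by rewrite expr2 mulrA ler_wpM2r.
  have h3 : yT ^+ 3 <= Kl ^+ 3 * S ^+ 3 by rewrite -exprMn lerXn2r// nnegrE mulr_ge0.
  have h4 : S ^+ 3 <= M * S ^+ 2.
    rewrite exprS ler_wpM2r// (le_trans SM)// ler_piMr//.
  have h5 := ler_wpM2l Kl3 h4; lra.
have g4 : K8 * (yT ^+ 2 + yT * S + yT ^+ 3) <=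
    K8 * (Kl ^+ 2 + Kl + Kl ^+ 3 * M) * (4 * L1 ^+ 2) * (T * E).
  have h1 := ler_wpM2l Kls S2; have h2 := ler_wpM2l K80 (le_trans g3 h1); lra.
have : D * T * E <= c0 / 2 * E by rewrite ler_wpM2r.
have -> : D * T * E = Kk * K2 * G * (T * E) + Kk * KR * h * (T * E) +
   K8 * (Kl ^+ 2 + Kl + Kl ^+ 3 * M) * (4 * L1 ^+ 2) * (T * E) by rewrite /D; ring.
lra.
Qed.

End remainder.
(** * The quadratic drift prevails in small time *)

Section obstruction.
Context {R : realType} {n : nat}.
Local Notation Rn := 'rV[R]_n.
Variables (f0 f1 f2 : Rn -> Rn) (A0 A1 A2 : 'M[R]_n).
Variables (Q0 Q1 Q2 : 'I_n -> 'M[R]_n) (C rho M : R) (b : Rn).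
Hypotheses (rho0 : 0 < rho) (C0 : 0 <= C) (M0 : 0 <= M).
Hypotheses (J0 : has_jet f0 0 A0 Q0 C rho) (J1 : has_jet f1 0 A1 Q1 C rho)
  (J2 : has_jet f2 0 A2 Q2 C rho).
Hypotheses (f00 : f0 0 = 0) (f10 : f1 0 = b) (f20 : f2 0 = 0).

Local Notation vel := (velocity f0 f1 f2).
Local Notation brk := (bracket2 A1 b).
Local Notation cub := (cubic A1 Q1 b).
Local Notation str := (straightened A1 Q1 b).
Local Notation dstr := (dstraightened f0 f1 f2 A1 Q1 b).
Local Notation rmd := (remainder f0 f1 f2 A0 A1 A2 Q0 Q1 Q2 b).

(* [P] stands for the reduction modulo [R1], so that [fun x => x *m P *m k] is a
   linear form vanishing on [R1]. *)
Variables (P : 'M[R]_n) (k l : 'cV[R]_n) (c0 : R).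
Hypotheses (bP : b *m P = 0)
  (PA0 : forall x : Rn, x *m P *m A0 *m P = x *m A0 *m P)
  (PA2 : forall x : Rn, x *m P *m A2 *m P = x *m A2 *m P)
  (bl : (b *m l) 0 0 = 1) (c00 : 0 < c0).

Lemma dstraightened_mod (y u1 u2 : R) (xi : Rn) : let w := str y xi *m P in
  dstr y u1 u2 xi *m P = w *m (A0 *m P) + u2 *: (w *m (A2 *m P))
    - (y ^+ 2 / 2) *: ((brk A0 Q0 + u2 *: brk A2 Q2) *m P) + rmd y u1 u2 xi *m P.
Proof.
have -> : dstr y u1 u2 xi = u1 *: b + str y xi *m A0 + u2 *: (str y xi *m A2)
     - (y ^+ 2 / 2) *: (brk A0 Q0 + u2 *: brk A2 Q2) + rmd y u1 u2 xi.
  by rewrite /remainder addrC subrK.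
move: (rmd _ _ _ _) (str _ _) => r W /=.
rewrite !mulmxA PA0 PA2; move: (brk A0 Q0 + _) => B.
by rewrite mulmxDl mulmxBl 2!mulmxDl -!scalemxAl bP scaler0 add0r.
Qed.

Lemma dstraightened_mod_bounds : exists K2 K3 KR Kk : R,
  [/\ 0 <= K2, 0 <= K3, 0 <= KR, 0 <= Kk &
  forall (y u1 u2 tau S : R) (xi : Rn), `|u1| <= M -> `|u2| <= M ->
    0 <= tau <= 1 -> `|y| <= M * tau -> `|xi| <= S -> S <= M * tau ->
    `|y *: b + xi| <= rho ->
    let w := str y xi *m P in
    let err := S * `|y| + (tau * y ^+ 2 + S ^+ 2) in
    `|dstr y u1 u2 xi *m P| <= K2 * `|w| + K3 * y ^+ 2 + KR * err /\
    (c0 <= ((brk A0 Q0 + u2 *: brk A2 Q2) *m P *m k) 0 0 ->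
     (dstr y u1 u2 xi *m P *m k) 0 0 <=
       Kk * (K2 * `|w|) - c0 / 2 * y ^+ 2 + Kk * (KR * err))].
Proof.
have [K K_0 hK] := remainder_bound C0 M0 J0 J1 J2 f00 f10 f20.
have [KP KP0 hP] := mulmx_bounded P.
have [KA KA0 hA] := mulmx_bounded (A0 *m P).
have [KB KB0 hB] := mulmx_bounded (A2 *m P).
have [Kk Kk0 hk] := col_bounded k.
have K20 : 0 <= KA + M * KB by rewrite addr_ge0// mulr_ge0.
have K30 : 0 <= KP * (`|brk A0 Q0| + M * `|brk A2 Q2|).
  by rewrite mulr_ge0// addr_ge0// mulr_ge0.
have KR0 : 0 <= KP * K by rewrite mulr_ge0.
exists (KA + M * KB), (KP * (`|brk A0 Q0| + M * `|brk A2 Q2|)), (KP * K), Kk.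
split => // y u1 u2 tau S xi u1M u2M t01 yt xiS St zr /=.
rewrite (dstraightened_mod y u1 u2 xi).
have remb : `|rmd y u1 u2 xi *m P| <= KP * K * (S * `|y| + (tau * y ^+ 2 + S ^+ 2)).
  apply: le_trans (hP _) _; rewrite -mulrA ler_wpM2l//.
  apply: le_trans (hK _ _ _ _ _ u1M u2M t01 yt (le_trans xiS St) zr) _.
  rewrite ler_wpM2l//.
  have h1 : `|y| * `|xi| <= `|y| * S by rewrite ler_wpM2l.
  have h2 : `|xi| ^+ 2 <= S ^+ 2.
    by rewrite lerXn2r// nnegrE// (le_trans _ xiS).
  by move: h1 h2; lra.
move: (rmd _ _ _ _ *m P) remb => r remb.
move: (str y xi *m P) => w.
have linb : `|w *m (A0 *m P) + u2 *: (w *m (A2 *m P))| <= (KA + M * KB) * `|w|.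
  rewrite (le_trans (ler_normD _ _))// normrZ mulrDl lerD//.
  by rewrite -mulrA ler_pM.
move: (w *m (A0 *m P) + _) linb => lin linb.
have y20 : 0 <= y ^+ 2 := sqr_ge0 _.
have y2h : 0 <= y ^+ 2 / 2 by rewrite divr_ge0.
have lamb : `|(brk A0 Q0 + u2 *: brk A2 Q2) *m P| <=
    KP * (`|brk A0 Q0| + M * `|brk A2 Q2|).
  rewrite (le_trans (hP _))// ler_wpM2l// (le_trans (ler_normD _ _))//.
  by rewrite lerD2l normrZ ler_wpM2r.
move: ((brk A0 Q0 + _) *m P) lamb K30 => la lamb K30.
move: (KP * (`|brk A0 Q0| + _)) K30 lamb => K3 K30 lamb.
move: (KA + M * KB) K20 linb => K2 K20 linb.
move: (KP * K) KR0 remb => KR KR0 remb.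
move: (S * `|y| + _) remb => err remb.
split.
  apply: le_trans (ler_normD _ _) _; apply: lerD => //.
  apply: le_trans (ler_normB _ _) _; apply: lerD => //.
  rewrite normrZ ger0_norm//; have := ler_wpM2l y2h lamb.
  have := mulr_ge0 K30 y20; lra.
move=> lam; rewrite mulmxDl mulmxBl -scalemxAl !rvE.
have h2 : (lin *m k) 0 0 <= Kk * (K2 * `|w|).
  by apply: le_trans (ler_norm _) _; apply: le_trans (hk _) _; rewrite ler_wpM2l.
have h3 : (r *m k) 0 0 <= Kk * (KR * err).
  by apply: le_trans (ler_norm _) _; apply: le_trans (hk _) _; rewrite ler_wpM2l.
have := ler_wpM2l y2h lam; move: h2 h3; lra.
Qed.

(** Undoing the straightening costs only terms of order 2: the term [y *: b] of
    order 1 is killed by [P]. *)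
Lemma straightened_correction : exists2 K8 : R, 0 <= K8 &
  forall (y S : R) (xi : Rn), `|xi| <= S ->
    ((y *: b + xi) *m P *m k) 0 0 <= (str y xi *m P *m k) 0 0 +
      K8 * (`|y| ^+ 2 + `|y| * S + `|y| ^+ 3).
Proof.
have [K4 K40 h4] := col_bounded (A1 *m P *m k).
exists (`|(b *m A1 *m P *m k) 0 0| + K4 + `|(cub *m P *m k) 0 0|) => [|y S xi xiS].
  by rewrite !addr_ge0.
have -> : ((y *: b + xi) *m P *m k) 0 0 = (str y xi *m P *m k) 0 0
    + (y ^+ 2 / 2 * (b *m A1 *m P *m k) 0 0
    + y * (xi *m (A1 *m P *m k)) 0 0 + y ^+ 3 * (cub *m P *m k) 0 0).
  rewrite /straightened; move: (y *: b + xi) cub => z' c'.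
  by rewrite !mulmxA !(mulmxDl, mulNmx, =^~ scalemxAl) !rvE; ring.
rewrite lerD2l.
move: ((b *m A1 *m P *m k) 0 0) ((cub *m P *m k) 0 0) => c1 c3.
have yn0 := normr_ge0 y; have y2 : `|y| ^+ 2 = y ^+ 2 by rewrite real_normK// num_real.
have p2 : 0 <= `|y| ^+ 2 := sqr_ge0 _.
have h1 : y ^+ 2 / 2 * c1 <= `|c1| * `|y| ^+ 2.
  have hc := ler_norm c1.
  have := ler_wpM2l p2 hc; have := mulr_ge0 (normr_ge0 c1) p2; rewrite y2; lra.
have h2 : y * (xi *m (A1 *m P *m k)) 0 0 <= K4 * (`|y| * S).
  apply: le_trans (ler_norm _) _; rewrite normrM mulrCA ler_wpM2l//.
  by rewrite (le_trans (h4 _))// ler_wpM2l.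
have h3 : y ^+ 3 * c3 <= `|c3| * `|y| ^+ 3.
  by apply: le_trans (ler_norm _) _; rewrite normrM normrX mulrC.
have p3 : 0 <= `|y| ^+ 3 by rewrite exprn_ge0.
have p1 : 0 <= `|y| * S by rewrite mulr_ge0// (le_trans _ xiS).
have q1 := mulr_ge0 (normr_ge0 c1) p1; have q2 := mulr_ge0 (normr_ge0 c1) p3.
have q3 := mulr_ge0 K40 p2; have q4 := mulr_ge0 K40 p3.
have q5 := mulr_ge0 (normr_ge0 c3) p1; have q6 := mulr_ge0 (normr_ge0 c3) p2.
lra.
Qed.

(** The condition on [l] at the final time, where [y T *: b + xi T] lies in the
    kernel of [l], makes [y T] of the order of [xi T]. *)
Lemma obstruction :
  exists2 T0 : R, 0 < T0 & forall (T : R) (u1 u2 : R -> R) (z : R -> Rn),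
    0 < T -> T <= T0 -> measurable_fun `[0, T] u1 ->
    (forall t, 0 <= t <= T -> `|u1 t| <= M) ->
    (forall t, 0 <= t <= T -> `|u2 t| <= M) ->
    (forall t, 0 <= t <= T ->
      c0 <= ((brk A0 Q0 + u2 t *: brk A2 Q2) *m P *m k) 0 0) ->
    row_primitive T z (fun t => vel (u1 t) (u2 t) (z t)) ->
    z 0 = 0 -> (forall t, 0 <= t <= T -> `|z t| <= rho) ->
    (z T *m l) 0 0 = 0 -> (z T *m P *m k) 0 0 <= 0.
Proof.
have [L L_0 hL] := drift_growth rho0 C0 M0 J0 J1 J2 f00 f10 f20.
have [K2 [K3 [KR [Kk [K20 K30 KR0 Kk0 hmod]]]]] := dstraightened_mod_bounds.
have [Kl Kl0 hl] := col_bounded l.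
have [K8 K80 hcor] := straightened_correction.
pose L1 := L * (`|b| + 1).
have L10 : 0 <= L1 by rewrite mulr_ge0// addr_ge0.
have [T1 T10 balance] := small_time_balance M0 L10 K20 K30 KR0 Kk0 K80 Kl0 c00.
exists (Num.min T1 (Num.min 1 (2 * L1 + 1)^-1)).
  by rewrite !lt_min T10 ltr01 invr_gt0 ltr_wpDl ?mulr_ge0.
move=> T u1 u2 z T_0; rewrite !le_min => /andP[TT1 /andP[T_1 TL]].
move=> mu1 u1M u2M lam Pz z0 zrho zl.
have T0 : 0 <= T by exact: ltW.
have {}TL : L1 * T <= 2^-1.
  have : T * (2 * L1 + 1) <= 1 by rewrite -ler_pdivlMr ?mul1r// ltr_wpDl ?mulr_ge0.
  lra.
have bu1 : exists N : R, forall t, 0 <= t <= T -> `|u1 t| <= N by exists M.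
have [y [Py y0]] : exists y, primitive T y u1 /\ y 0 = 0.
  exists (fun t => \int[@lebesgue_measure R]_(s in `[0, t]) u1 s).
  by split; [exact: primitive_integral|rewrite set_itv1 Rintegral_set1].
have yMT t : 0 <= t <= T -> `|y t| <= M * T.
  move=> /andP[t0 tT].
  have b1 r : 0 <= r <= t -> - M <= u1 r <= M.
    by move=> /andP[r0 rt]; rewrite -ler_norml u1M// r0 (le_trans rt).
  have b2 r : 0 <= r <= t -> u1 r <= M * 1 by move=> /b1/andP[]; rewrite mulr1.
  have b3 r : 0 <= r <= t -> - M * 1 <= u1 r by move=> /b1/andP[]; rewrite mulr1.
  have h1 := le_primitive Py (primitiveZ M (primitive_id T)) (lexx 0) t0 tT b2.
  have h2 := le_primitive (primitiveZ (- M) (primitive_id T)) Py (lexx 0) t0 tT b3.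
  have := ler_wpM2l M0 tT; move: h1 h2; rewrite /= y0 ler_norml => h1 h2 h3.
  by apply/andP; split; lra.
have [I [E En]] := energy_exists T_0 Py.
have I0 := energy_I_ge0 En; have E0 := energy_E_ge0 En.
have [Pxi PW] := straightened_primitive A1 Q1 b Py Pz.
have [xi xiE] : exists xi : R -> Rn, xi = fun t => z t - y t *: b by eexists.
rewrite /= -xiE in Pxi; rewrite /= in PW.
have zE t : z t = y t *: b + xi t by rewrite xiE addrC subrK.
have xi0 : xi 0 = 0 by rewrite xiE z0 y0 scale0r subrr.
have {xiE}PW : row_primitive T (fun t => str (y t) (xi t))
    (fun t => dstr (y t) (u1 t) (u2 t) (xi t)) by rewrite xiE; exact: PW.
have xib t : 0 <= t <= T -> `|vel (u1 t) (u2 t) (z t) - u1 t *: b| <=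
    L1 * `|xi t| + (L1 * `|y t| + (0 * y t ^+ 2 + 0)).
  move=> tT; apply: le_trans (hL _ _ _ (u1M _ tT) (u2M _ tT) (zrho _ tT)) _.
  have h : `|z t| <= `|y t| * `|b| + `|xi t|.
    by rewrite zE (le_trans (ler_normD _ _))// normrZ.
  have := ler_wpM2l L_0 h; rewrite /L1.
  have := mulr_ge0 L_0 (mulr_ge0 (normr_ge0 b) (normr_ge0 (xi t))).
  have := mulr_ge0 L_0 (normr_ge0 (y t)); lra.
have [S [S0 xiS hS]] := linear_growth T0 En Pxi xi0 L10 L10 (lexx 0) (lexx 0) xib.
have {}hS : S <= 2 * L1 * I.
  have := ler_wpM2r S0 TL; move: hS; lra.
have SMT : S <= M * T.
  have h1 := ler_wpM2l L10 (energy_I_le En yMT).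
  have h2 := ler_wpM2r (mulr_ge0 M0 T0) TL; move: hS h1 h2; lra.
have T01 : 0 <= T <= 1 by rewrite T0.
have zr t : 0 <= t <= T -> `|y t *: b + xi t| <= rho by move=> tT; rewrite -zE zrho.
have hm t (tT : 0 <= t <= T) := hmod (y t) (u1 t) (u2 t) T S (xi t) (u1M t tT)
   (u2M t tT) T01 (yMT t tT) (xiS t tT) SMT (zr t tT).
have PwP := row_primitive_mulmx P PW.
have w0 : str (y 0) (xi 0) *m P = 0 by rewrite y0 xi0 straightened0 mul0mx.
have wb t : 0 <= t <= T -> `|dstr (y t) (u1 t) (u2 t) (xi t) *m P| <=
    K2 * `|str (y t) (xi t) *m P| +
    (KR * S * `|y t| + ((K3 + KR * T) * y t ^+ 2 + KR * S ^+ 2)).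
  by move=> tT; have [h _] := hm t tT; apply: le_trans h _; lra.
have KS : 0 <= KR * S by rewrite mulr_ge0.
have KT : 0 <= K3 + KR * T by rewrite addr_ge0// mulr_ge0.
have KS2 : 0 <= KR * S ^+ 2 by apply: mulr_ge0 => //; exact: sqr_ge0.
have [Sw [Sw0 wS hSw]] := linear_growth T0 En PwP w0 K20 KS KT KS2 wb.
have TT : 0 <= T <= T by rewrite T0 lexx.
have sb t : 0 <= t <= T -> (dstr (y t) (u1 t) (u2 t) (xi t) *m P *m k) 0 0 <=
    Kk * (KR * S) * `|y t| + ((Kk * (KR * T) - c0 / 2) * y t ^+ 2
      + (Kk * (K2 * Sw) + Kk * (KR * S ^+ 2))).
  move=> tT; have [_ /(_ (lam t tT)) h] := hm t tT; apply: le_trans h _.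
  have := ler_wpM2l Kk0 (ler_wpM2l K20 (wS t tT)); lra.
have hs := energy_scalar En (primitive_mul_col k PwP) sb.
rewrite /= w0 mul0mx [X in _ - X <= _]mxE subr0 in hs.
have yl : y T = - (xi T *m l) 0 0.
  by move: zl; rewrite zE mulmxDl -scalemxAl !rvE bl mulr1 => h; lra.
have yS : `|y T| <= Kl * S.
  by rewrite yl normrN (le_trans (hl _))// ler_wpM2l// xiS.
have hz := hcor (y T) S (xi T) (xiS T TT); rewrite -zE in hz.
apply: (balance T S I E Sw _ _ `|y T| T_0 TT1 S0 I0 E0 Sw0 hS
  (energy_cauchy_schwarz En) SMT _ _ (normr_ge0 _) yS hz).
  by move: hSw; lra.
by move: hs; lra.
Qed.

End obstruction.
(** * Norms of controls and regularity of solutions *)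

Section plane_norms.
Context {R : realType}.
Variable N : R * R -> R.
Hypothesis normN : is_norm N.

Lemma is_norm0 : N 0 = 0.
Proof. by have := is_norm_scale normN 0 0; rewrite !mul0r normr0 mul0r. Qed.

Lemma is_normN u : N (- u) = N u.
Proof.
have := is_norm_scale normN (-1) u; rewrite !mulN1r normrN1 mul1r => <-.
by case: u.
Qed.

Lemma is_norm_ge0 u : 0 <= N u.
Proof.
have := is_norm_triangle normN u (- u); rewrite subrr is_norm0 is_normN; lra.
Qed.

Lemma is_norm_swap : is_norm (fun u => N (u.2, u.1)).
Proof.
split => [u v|a u|[u v]].
- exact: (is_norm_triangle normN (u.2, u.1) (v.2, v.1)).
- exact: (is_norm_scale normN a (u.2, u.1)).
- by move=> /(is_norm_eq0 normN)[-> ->].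
Qed.

(** By homogeneity it suffices to bound the norm from below on the compact segment
    [u.1 = 1, |u.2| <= 1]. *)
Lemma is_norm_cone : exists2 m : R, 0 < m &
  forall u, `|u.2| <= `|u.1| -> m * `|u.1| <= N u.
Proof.
(* shifted, so that the segment is parametrized by [[0, 2]] *)
pose F (s : R) := N (1, s - 1).
have FL s t : 0 <= s -> s <= t -> t <= 2 -> `|F t - F s| <= N (0, 1) * (t - s).
  move=> s0 st t2.
  have e : N (0, t - s) = N (0, 1) * (t - s).
    have := is_norm_scale normN (t - s) (0, 1) => /=.
    by rewrite mulr0 mulr1 ger0_norm ?subr_ge0// mulrC.
  have h1 : F t <= F s + N (0, 1) * (t - s).
    have := is_norm_triangle normN (1, s - 1) (0, t - s); rewrite -e.
    by rewrite /F [X in N X](_ : _ = (1, t - 1))//; congr (_, _) => /=; ring.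
  have h2 : F s <= F t + N (0, 1) * (t - s).
    have := is_norm_triangle normN (1, t - 1) (- (0, t - s)); rewrite is_normN -e.
    by rewrite /F [X in N X](_ : _ = (1, s - 1))//; congr (_, _) => /=; ring.
  rewrite ler_norml; apply/andP; split; lra.
have cF := lipschitz_within_continuous (is_norm_ge0 (0, 1)) FL.
have [c c02 cmin] := EVT_min (ler0n _ 2) cF.
have Fc : 0 < F c.
  rewrite lt_neqAle is_norm_ge0 andbT eq_sym; apply/eqP => /(is_norm_eq0 normN)[].
  by move=> /eqP; rewrite oner_eq0.
exists (F c) => // -[a b] /= ba.
have [->|a0] := eqVneq a 0; first by rewrite normr0 mulr0 is_norm_ge0.
have := is_norm_scale normN a (1, b / a); rewrite /= mulr1 mulrC divfK// => ->.
rewrite mulrC ler_wpM2l//.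
have ba1 : `|b / a| <= 1 by rewrite normrM normfV ler_pdivrMr ?normr_gt0// mul1r.
have := cmin (b / a + 1); rewrite /F addrK; apply.
by move: ba1; rewrite in_itv/= ler_norml => /andP[? ?]; apply/andP; split; lra.
Qed.

End plane_norms.

Lemma is_norm_equiv {R : realType} (N : R * R -> R) : is_norm N ->
  exists2 K : R, 0 <= K & forall u, `|u.1| <= K * N u /\ `|u.2| <= K * N u.
Proof.
move=> normN; have [m m0 hm] := is_norm_cone normN.
have [m' m'0 hm'] := is_norm_cone (is_norm_swap normN).
have K0 : 0 <= m^-1 + m'^-1 by rewrite addr_ge0// invr_ge0 ltW.
exists (m^-1 + m'^-1) => // u; have Nu := is_norm_ge0 normN u.
have [u21|/ltW u12] := leP `|u.2| `|u.1|.
  have h : `|u.1| <= (m^-1 + m'^-1) * N u.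
    rewrite mulrDl ler_wpDr ?mulr_ge0 ?invr_ge0 ?(ltW m'0)//.
    by rewrite ler_pdivlMl// hm.
  by split=> //; exact: le_trans u21 h.
have h : `|u.2| <= (m^-1 + m'^-1) * N u.
  rewrite mulrDl ler_wpDl ?mulr_ge0 ?invr_ge0 ?(ltW m0)//.
  rewrite ler_pdivlMl//; have := hm' (u.2, u.1) u12; by case: (u).
by split=> //; exact: le_trans u12 h.
Qed.

Section solutions.
Context {R : realType} {n : nat}.
Local Notation Rn := 'rV[R]_n.
Local Notation mu := (@lebesgue_measure R).

Lemma Linfty_norm_ae (N : R * R -> R) (T c : R) (u : R -> R * R) : 0 < T ->
  (Linfty_norm N T u <= c%:E)%E ->
  exists B : set R, [/\ measurable B, mu (B `&` `[0, T]) = 0%E &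
    forall t, ~ B t -> N (u t) <= c].
Proof.
move=> T0; rewrite /Linfty_norm unlock /=.
have -> : (0 < mrestr mu (measurable_itv `[0%R, T]) [set: R])%E.
  by rewrite /mrestr setTI lebesgue_measure_itv/= lte_fin T0 lte_fin subr0.
move=> /ess_supP[B [mB B0 NB]]; exists B; split => //.
move=> t nBt; apply: contrapT => h; apply: nBt; apply: NB => /= h'; apply: h.
by move: h'; rewrite lee_fin; exact: le_trans (ler_norm _).
Qed.

(** As long as the state stays in the ball of radius [rho], its speed is at
    most [F]; over a time shorter than [rho / (2 * F)] it cannot leave it. *)
Lemma stays_in_ball (T F rho : R) (V v : R -> Rn) : 0 < rho ->
  row_primitive T V v -> V 0 = 0 ->
  (forall t, 0 <= t <= T -> `|V t| <= rho -> `|v t| <= F) ->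
  0 <= F -> F * T <= rho / 2 ->
  forall t, 0 <= t <= T -> `|V t| <= rho.
Proof.
move=> rho0 PV V0 vF F0 FT.
have [M M0 VM] := row_primitive_lip PV.
pose d := rho / 2 / (M + 1).
have M1 : 0 < M + 1 by rewrite ltr_wpDl.
have d0 : 0 < d by rewrite !divr_gt0.
have Md : M * d <= rho / 2.
  have : (M + 1) * d = rho / 2 by rewrite mulrC divfK// gt_eqF.
  lra.
suff H (i : nat) t : 0 <= t <= T -> t <= i%:R * d -> `|V t| <= rho.
  move=> t tT; apply: (H (Num.trunc (t / d)).+1) => //.
  by rewrite -ler_pdivrMr//; exact/ltW/truncnS_gt.
(* On a step of length [d] the state moves by less than [rho / 2], and at the
   beginning of each step the speed bound leaves it within [rho / 2]. *)
elim: i t => [|i IH] t /andP[t0 tT].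
  rewrite mul0r => t0'; have -> : t = 0 by apply/eqP; rewrite eq_le t0 t0'.
  by rewrite V0 normr0 ltW.
have [ti _|it ti] := leP t (i%:R * d); first by apply: IH; rewrite ?t0.
set s := i%:R * d in it IH ti.
have s0 : 0 <= s by rewrite mulr_ge0// ltW.
have sT : s <= T by rewrite (le_trans (ltW it)).
have Vs : `|V s| <= rho / 2.
  have hh r : 0 <= r <= s -> `|v r| <= F * 1.
    move=> /andP[r0 rs]; rewrite mulr1; have rT : 0 <= r <= T by rewrite r0 (le_trans rs).
    exact: vF (IH _ _ _).
  have := row_primitive_norm_le PV (primitiveZ F (primitive_id T)) (lexx 0) s0 sT hh.
  rewrite V0 subr0 /= mulr0 subr0 => h; apply: le_trans h _.
  by apply: le_trans FT; rewrite ler_wpM2l.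
have h1 := VM s t s0 (ltW it) tT.
have h2 : M * (t - s) <= M * d.
  by rewrite ler_wpM2l//; move: ti; rewrite /s -natr1; lra.
have := ler_normD (V t - V s) (V s); rewrite subrK; lra.
Qed.

Variables (f0 f1 f2 : Rn -> Rn).
Hypotheses (cf0 : continuous f0) (cf1 : continuous f1) (cf2 : continuous f2).

Lemma comp_continuous (T : R) (z : R -> Rn) (f : Rn -> Rn) i :
  {within `[0, T], continuous z} -> continuous f ->
  {within `[0, T], continuous (fun t => f (z t) 0 i)}.
Proof.
move=> cz cf t.
apply: (@continuous_comp (subspace `[0, T]) Rn R z (fun x => f x 0 i) t (cz t)).
apply: (@continuous_comp Rn Rn R f (fun y => y 0 i) (z t) (cf (z t))).
exact: coord_continuous.
Qed.

(** Controls are bounded only almost everywhere; changing them on a null set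
    does not change the solution, which is then Lipschitz. *)
Lemma solution_row_primitive (T M : R) (u : R -> R * R) (v1 v2 : R -> R)
    (z : R -> Rn) (B : set R) : 0 <= T ->
  is_solution f0 f1 f2 T u z -> measurable_fun `[0, T] u ->
  measurable_fun `[0, T] v1 -> measurable_fun `[0, T] v2 ->
  (forall t, `|v1 t| <= M) -> (forall t, `|v2 t| <= M) ->
  measurable B -> mu (B `&` `[0, T]) = 0%E ->
  (forall t, ~ B t -> u t = (v1 t, v2 t)) ->
  row_primitive T z (fun t => velocity f0 f1 f2 (v1 t) (v2 t) (z t)).
Proof.
move=> T0 [cz zint] mu_ mv1 mv2 v1M v2M mB B0 uv i.
have mf (f : Rn -> Rn) : continuous f -> measurable_fun `[0, T] (fun t => f (z t) 0 i).
  move=> cf; apply: subspace_continuous_measurable_fun => //.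
  exact: comp_continuous.
have bf (f : Rn -> Rn) : continuous f -> exists N : R, forall t, 0 <= t <= T -> `|f (z t) 0 i| <= N.
  move=> cf.
  have cn : {within `[0, T], continuous (fun t => `|f (z t) 0 i|)}.
    have h := comp_continuous (i := i) cz cf; move=> t.
    have := @continuous_comp (subspace `[0, T]) R R _ Num.norm t (h t).
    apply; exact: norm_continuous.
  have [c _ cmax] := EVT_max T0 cn; exists `|f (z c) 0 i| => t tT.
  by apply: cmax; rewrite in_itv.
have mvel (w1 w2 : R -> R) : measurable_fun `[0, T] w1 -> measurable_fun `[0, T] w2 ->
    measurable_fun `[0, T] (fun t => (f0 (z t) + w1 t *: f1 (z t) + w2 t *: f2 (z t)) 0 i).
  move=> mw1 mw2.
  have -> : (fun t => (f0 (z t) + w1 t *: f1 (z t) + w2 t *: f2 (z t)) 0 i) =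
      (fun t => f0 (z t) 0 i + w1 t * f1 (z t) 0 i + w2 t * f2 (z t) 0 i).
    by apply/funext => t; rewrite !rvE.
  exact: (measurable_funD (measurable_funD (mf _ cf0) (measurable_funM mw1 (mf _ cf1)))
    (measurable_funM mw2 (mf _ cf2))).
have mu1 : measurable_fun `[0, T] (fun t => (u t).1) by exact: measurableT_comp.
have mu2 : measurable_fun `[0, T] (fun t => (u t).2) by exact: measurableT_comp.
split; first exact: mvel.
- have [N0 h0] := bf _ cf0; have [N1 h1] := bf _ cf1; have [N2 h2] := bf _ cf2.
  exists (N0 + M * N1 + M * N2) => t tT; rewrite /velocity !rvE.
  rewrite (le_trans (ler_normD _ _))// lerD// ?normrM ?ler_pM ?h2//.
  by rewrite (le_trans (ler_normD _ _))// lerD ?h0// normrM ler_pM ?h1.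
move=> t /andP[t0 tT]; rewrite zint ?in_itv/= ?t0//; congr (_ + _).
have st : `[0, t] `<=` `[0, T] by apply: subset_itvl; rewrite bnd_simp.
rewrite /Rintegral; congr fine; apply: ae_eq_integral => //.
- by apply/measurable_EFinP; apply: measurable_funS (mvel _ _ mu1 mu2).
- by apply/measurable_EFinP; apply: measurable_funS (mvel _ _ mv1 mv2).
exists (B `&` `[0, T]); split => //; first exact: measurableI.
move=> s /= /not_implyP[st0 ne]; split; last exact: st.
apply: contrapT => /uv us; apply: ne; by rewrite /velocity us.
Qed.

End solutions.

(** * Linear algebra of the subspace R1 *)

Section linear_algebra.
Context {R : realType} {n : nat}.
Local Notation Rn := 'rV[R]_n.

(** Among the finite families of [S], one of maximal rank spans everything. *)
Lemma lin_span_vspace (S : set Rn) :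
  exists U : {vspace Rn}, forall v, lin_span S v <-> v \in U.
Proof.
pose P d := `[< exists2 s : seq Rn, (forall x, x \in s -> S x) & \dim << s >>%VS = d >].
have P0 : exists d, P d by exists 0%N; apply/asboolP; exists [::] => //; rewrite span_nil dimv0.
have Pn d : P d -> (d <= \dim {: Rn})%N.
  by move=> /asboolP[s _ <-]; apply: dimvS; exact: subvf.
have [d /asboolP[s sS sd] dmax] := ex_maxnP P0 Pn.
exists << s >>%VS => v; split => [[s' s'S vs']|]; last by exists s.
have ss' : (<< s >> <= << s ++ s' >>)%VS by rewrite span_cat addvSl.
have : (\dim << s ++ s' >> <= d)%N.
  apply: dmax; apply/asboolP; exists (s ++ s') => // x.
  by rewrite mem_cat => /orP[/sS|/s'S].
rewrite -sd => dle.
have /eqP -> : << s >>%VS == << s ++ s' >>%VS by rewrite eqEdim ss'.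
by rewrite span_cat (subvP (addvSr _ _)).
Qed.

Lemma vspace_projector (U : {vspace Rn}) : exists P : 'M[R]_n,
  (forall x : Rn, x *m P = 0 <-> x \in U) /\ (forall x : Rn, x - x *m P \in U).
Proof.
exists (1%:M - lin1_mx (projv U)).
have PE (x : Rn) : x *m (1%:M - lin1_mx (projv U)) = x - projv U x.
  by rewrite mulmxBr mulmx1 mul_rV_lin1.
split=> x; rewrite PE; last by rewrite opprB addrC subrK memv_proj.
split; last by move=> xU; rewrite projv_id// subrr.
by move=> /eqP; rewrite subr_eq0 => /eqP ->; exact: memv_proj.
Qed.

Lemma span_mulmx_stable (S : set Rn) (U : {vspace Rn}) (A : 'M[R]_n) :
  (forall v, lin_span S v <-> v \in U) ->
  (forall x, S x -> x *m A \in U) -> forall x, x \in U -> x *m A \in U.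
Proof.
move=> SU SA x /SU[s sS xs].
pose g := linfun (mulmxr A : Rn -> Rn).
have gE (v : Rn) : g v = v *m A by rewrite lfunE.
suff : (<< s >> <= g @^-1: U)%VS.
  by move=> /subvP /(_ _ xs); rewrite -memv_preim gE.
by apply/span_subvP => v vs; rewrite -memv_preim gE; exact: SA (sS _ vs).
Qed.

End linear_algebra.
(** * Non-controllability *)

Section main.
Context {R : realType} {n : nat}.
Local Notation Rn := 'rV[R]_n.

Definition clamp (c m x : R) := Num.max (c - m) (Num.min (c + m) x).

Lemma clamp_dist c m x : 0 <= m -> `|clamp c m x - c| <= m.
Proof.
move=> m0; rewrite /clamp.
by case: (leP (c + m) x) => h1; case: (leP (c - m) _) => h2; rewrite ler_norml; apply/andP; split; lra.
Qed.

Lemma clamp_id c m x : `|x - c| <= m -> clamp c m x = x.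
Proof.
rewrite ler_norml /clamp => /andP[h1 h2].
by case: (leP (c + m) x) => h3; case: (leP (c - m) _) => h4; lra.
Qed.

Lemma measurable_clamp (D : set R) c m (f : R -> R) :
  measurable_fun D f -> measurable_fun D (fun t => clamp c m (f t)).
Proof.
move=> mf; apply: measurable_maxr; first exact: measurable_cst.
by apply: measurable_minr => //; exact: measurable_cst.
Qed.

Lemma has_jet_weaken (f : Rn -> Rn) c A Q (C C' rho rho' : R) :
  C <= C' -> rho' <= rho -> has_jet f c A Q C rho -> has_jet f c A Q C' rho'.
Proof.
move=> CC rr J s x y sr xs ys.
apply: le_trans (J s x y (le_trans sr rr) xs ys) _.
by rewrite ler_wpM2r// ler_wpM2r// sqr_ge0.
Qed.

Lemma euclidean_ball0 (eta : R) : 0 < eta -> euclidean_ball (0 : Rn) eta 0.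
Proof.
by move=> e0; rewrite /euclidean_ball /= big1 ?sqrtr0// => i _; rewrite subrr expr0n.
Qed.

Lemma euclidean_ball_scale (w : Rn) (eta : R) : 0 < eta ->
  exists2 d : R, 0 < d & euclidean_ball 0 eta (d *: w).
Proof.
move=> e0; pose s := Num.sqrt (\sum_(i < n) w 0 i ^+ 2).
have s0 : 0 <= s := sqrtr_ge0 _.
have s1 : 0 < s + 1 by rewrite ltr_wpDl.
exists (eta / (s + 1)); first by rewrite divr_gt0.
rewrite /euclidean_ball /=.
have -> : \sum_(i < n) ((eta / (s + 1) *: w) 0 i - (0 : Rn) 0 i) ^+ 2 =
    (eta / (s + 1)) ^+ 2 * \sum_(i < n) w 0 i ^+ 2.
  by rewrite mulr_sumr; apply: eq_bigr => i _; rewrite !rvE subr0 exprMn.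
rewrite sqrtrM ?sqr_ge0// sqrtr_sqr ger0_norm ?divr_ge0 ?(ltW e0) ?(ltW s1)//.
by rewrite -/s mulrAC ltr_pdivrMr// ltr_pM2l// ltrDl.
Qed.

Section obstructed.
Variables (N : R * R -> R) (f0 f1 f2 : Rn -> Rn).
Hypothesis normN : is_norm N.
Hypotheses (an0 : real_analytic_field f0) (an1 : real_analytic_field f1)
  (an2 : real_analytic_field f2).
Variables (A0 A1 A2 : 'M[R]_n) (Q0 Q1 Q2 : 'I_n -> 'M[R]_n) (C rho : R).
Local Notation b := (f1 0).
Hypotheses (rho0 : 0 < rho) (C0 : 0 <= C).
Hypotheses (J0 : has_jet f0 0 A0 Q0 C rho) (J1 : has_jet f1 0 A1 Q1 C rho)
  (J2 : has_jet f2 0 A2 Q2 C rho).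
Hypotheses (f00 : f0 0 = 0) (f20 : f2 0 = 0) (f10 : f1 0 <> 0).
Variables (P : 'M[R]_n) (k : 'cV[R]_n).
Hypotheses (bP : b *m P = 0)
  (PA0 : forall x : Rn, x *m P *m A0 *m P = x *m A0 *m P)
  (PA2 : forall x : Rn, x *m P *m A2 *m P = x *m A2 *m P).
Local Notation lambda v :=
  (((bracket2 A1 b A0 Q0 + v *: bracket2 A1 b A2 Q2) *m P *m k) 0 0).

(** Starting from the origin, the target is taken in a hyperplane transverse to
    [b], on the side where the linear form is positive. The sign condition
    involves a constant [K] because admissible controls are bounded for [N],
    hence only up to a constant in each coordinate. *)
Lemma not_alpha_STLC (alpha u2eq : R) : 0 <= alpha ->
  (forall K : R, 0 <= K -> exists e0 c0 : R, [/\ 0 < e0, 0 < c0 &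
    forall v, `|v - u2eq| <= K * (alpha + e0) -> c0 <= lambda v]) ->
  ~ alpha_STLC N f0 f1 f2 alpha 0 (0, u2eq).
Proof.
move=> al0 sign stlc.
have [K K0 hK] := is_norm_equiv normN.
have [e0 [c0 [e00 c00 hlam]]] := sign K K0.
have [i0 bi0] : exists i, b 0 i != 0.
  apply: contrapT => /forallNP h; apply: f10; apply/rowP => i; rewrite rvE.
  by apply/eqP/negPn/negP/h.
pose l : 'cV[R]_n := (b 0 i0)^-1 *: delta_mx i0 0.
have bl : (b *m l) 0 0 = 1 by rewrite -scalemxAr -colE !mxE mulVf.
pose M := `|u2eq| + K * (alpha + 1).
have Ka1 : 0 <= K * (alpha + 1) by rewrite mulr_ge0// addr_ge0.
have M0 : 0 <= M by rewrite addr_ge0.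
have [T0 T00 obs] := obstruction rho0 C0 M0 J0 J1 J2 f00 erefl f20 k bP PA0 PA2 bl c00.
have [L L0 hL] := drift_growth rho0 C0 M0 J0 J1 J2 f00 erefl f20.
pose F := L * rho + M * `|b|.
have F0 : 0 <= F by rewrite addr_ge0// mulr_ge0// ltW.
have F1 : 0 < 2 * F + 1 by rewrite ltr_wpDl// mulr_ge0.
(* The horizon is also the tolerance on the control. *)
pose T := Num.min (Num.min e0 1) (Num.min T0 (rho / (2 * F + 1))).
have T_0 : 0 < T by rewrite !lt_min e00 ltr01 T00 divr_gt0.
have [Te0 [T1 [TT0 TF]]] : T <= e0 /\ T <= 1 /\ T <= T0 /\ T <= rho / (2 * F + 1).
  by have := lexx T; rewrite {2}/T !le_min => /andP[/andP[-> ->] /andP[-> ->]].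
have FT : F * T <= rho / 2.
  have h : T * (2 * F + 1) <= rho by rewrite -ler_pdivlMr.
  have := ltW T_0; lra.
have [eta eta0 reach] := stlc T T_0.
pose w := bracket2 A1 b A0 Q0 + u2eq *: bracket2 A1 b A2 Q2.
have wk : 0 < (w *m P *m k) 0 0.
  apply: lt_le_trans c00 (hlam u2eq _).
  by rewrite subrr normr0 mulr_ge0// addr_ge0// ltW.
pose w' := w - (w *m l) 0 0 *: b.
have w'l : (w' *m l) 0 0 = 0 by rewrite /w' mulmxBl -scalemxAl !rvE bl mulr1 subrr.
have w'k : (w' *m P *m k) 0 0 = (w *m P *m k) 0 0.
  by rewrite /w' mulmxBl -scalemxAl bP scaler0 subr0.
have [d d0 dball] := euclidean_ball_scale w' eta0.
have [u [z [[mu_ _] sol z0 zT uT]]] := reach 0 (d *: w') (euclidean_ball0 eta0) dball.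
have [B [mB B0 uB]] := Linfty_norm_ae T_0 uT.
pose m := K * (alpha + T).
have m0 : 0 <= m by rewrite mulr_ge0// addr_ge0// ltW.
have m1 : m <= K * (alpha + 1) by rewrite ler_wpM2l// lerD2l.
(* The bounds on [u] hold almost everywhere, those on its truncation
   everywhere. *)
pose v1 t := clamp 0 m (u t).1; pose v2 t := clamp u2eq m (u t).2.
have v1M t : `|v1 t| <= M.
  have := clamp_dist 0 (u t).1 m0; rewrite subr0 -/(v1 t) => h.
  by rewrite (le_trans h)// (le_trans m1)// lerDr.
have v2d t : `|v2 t - u2eq| <= m by exact: clamp_dist.
have v2M t : `|v2 t| <= M.
  rewrite -(subrK u2eq (v2 t)) (le_trans (ler_normD _ _))// addrC lerD2l.
  exact: le_trans (v2d t) m1.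
have uv t : ~ B t -> u t = (v1 t, v2 t).
  move=> /uB ut; have [/= h1 h2] := hK (u t - (0, u2eq)).
  have hm : K * N (u t - (0, u2eq)) <= m by rewrite ler_wpM2l.
  rewrite /v1 /v2 !clamp_id; first by case: (u t).
    exact: le_trans h2 hm.
  exact: le_trans h1 hm.
have T_ge0 := ltW T_0.
have mv1 : measurable_fun `[0, T] v1.
  by apply: measurable_clamp; exact: measurableT_comp.
have mv2 : measurable_fun `[0, T] v2.
  by apply: measurable_clamp; exact: measurableT_comp.
have cf0 := analytic_field_continuous an0.
have cf1 := analytic_field_continuous an1.
have cf2 := analytic_field_continuous an2.
have Pz := solution_row_primitive cf0 cf1 cf2 T_ge0 sol mu_ mv1 mv2 v1M v2M mB B0 uv.
have speed t : 0 <= t <= T -> `|z t| <= rho ->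
    `|velocity f0 f1 f2 (v1 t) (v2 t) (z t)| <= F.
  move=> _ zr; rewrite -(subrK (v1 t *: b) (velocity _ _ _ _ _ _)).
  rewrite (le_trans (ler_normD _ _))// lerD//.
    by rewrite (le_trans (hL _ _ _ (v1M t) (v2M t) zr))// ler_wpM2l.
  by rewrite normrZ ler_wpM2r.
have zrho := stays_in_ball rho0 Pz z0 speed F0 FT.
have zl : (z T *m l) 0 0 = 0 by rewrite zT -scalemxAl rvE w'l mulr0.
have lam t : 0 <= t <= T -> c0 <= lambda (v2 t).
  by move=> _; apply: hlam; rewrite (le_trans (v2d t))// ler_wpM2l// lerD2l.
have := obs T v1 v2 z T_0 TT0 mv1 (fun t _ => v1M t) (fun t _ => v2M t) lam Pz z0 zrho zl.
by rewrite zT -!scalemxAl rvE w'k leNgt mulr_gt0.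
Qed.

End obstructed.

(** Bracketing with a field that contains no [f1] stays among the generators of
    [R1], and acts on values at 0 as [- A]. *)
Lemma R1_at0_mulmx (f0 f1 f2 g : Rn -> Rn) (U : {vspace Rn}) A Q (C rho : R) :
  0 < rho -> 0 <= C -> has_jet g 0 A Q C rho -> g 0 = 0 ->
  iterated_bracket f0 f1 f2 0 g ->
  (forall v, R1_at0 f0 f1 f2 v <-> v \in U) ->
  forall x, x \in U -> x *m A \in U.
Proof.
move=> rho0 C0 J g0 gbr RU; apply: (span_mulmx_stable RU) => x [m [h [m1 hbr ->]]].
rewrite -memvN -(bracket_at0 h rho0 C0 J g0); apply/RU.
exists [:: lie_bracket g h 0]; last by rewrite memv_span// mem_head.
move=> y; rewrite inE => /eqP ->; exists m, (lie_bracket g h); split => //.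
by have := iterated_lie gbr hbr; rewrite add0n.
Qed.

End main.

Lemma common_jets {R : realType} {n : nat} (f0 f1 f2 : 'rV[R]_n -> 'rV[R]_n) :
  real_analytic_field f0 -> real_analytic_field f1 -> real_analytic_field f2 ->
  exists (A : 'I_3 -> 'M[R]_n) (Q : 'I_3 -> 'I_n -> 'M[R]_n) (C rho : R),
  [/\ 0 < rho, 0 <= C, has_jet f0 0 (A 0) (Q 0) C rho,
      has_jet f1 0 (A 1) (Q 1) C rho & has_jet f2 0 (A 2) (Q 2) C rho].
Proof.
move=> an0 an1 an2.
have [A0 [Q0 [C0 [r0 [r00 C00 J0]]]]] := analytic_field_jet 0 an0.
have [A1 [Q1 [C1 [r1 [r10 C10 J1]]]]] := analytic_field_jet 0 an1.
have [A2 [Q2 [C2 [r2 [r20 C20 J2]]]]] := analytic_field_jet 0 an2.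
exists (fun i => tnth [tuple A0; A1; A2] i), (fun i => tnth [tuple Q0; Q1; Q2] i).
exists (C0 + C1 + C2), (Num.min r0 (Num.min r1 r2)).
split; [by rewrite !lt_min r00 r10|by rewrite !addr_ge0|..].
- by apply: has_jet_weaken J0; rewrite ?ge_min ?lexx//; lra.
- by apply: has_jet_weaken J1; rewrite ?ge_min ?lexx ?orbT//; lra.
- by apply: has_jet_weaken J2; rewrite ?ge_min ?lexx ?orbT//; lra.
Qed.

Theorem theorem1 (R : realType) (n : nat) (N : R * R -> R)
    (f0 f1 f2 : 'rV[R]_n -> 'rV[R]_n)
    (normN : is_norm N)
    (f0_analytic : real_analytic_field f0)
    (f1_analytic : real_analytic_field f1)
    (f2_analytic : real_analytic_field f2)
    (f00 : f0 0 = 0) (f20 : f2 0 = 0) (f10 : f1 0 <> 0)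
    (B1_notin : ~ R1_at0 f0 f1 f2 (lie_bracket f1 (lie_bracket f0 f1) 0)) :
  let B1 := lie_bracket f1 (lie_bracket f0 f1) in
  let C := lie_bracket f1 (lie_bracket f2 f1) in
  let R1 := R1_at0 f0 f1 f2 in
  (sum_set R1 (lin_span [set C 0]) (B1 0) ->
    forall beta : R, R1 (B1 0 + beta *: C 0) ->
    forall u2eq : R, u2eq <> beta -> ~ STLC N f0 f1 f2 0 (0, u2eq)) /\
  (~ sum_set R1 (lin_span [set C 0]) (B1 0) ->
    forall u2eq alpha : R, 0 <= alpha ->
    ~ alpha_STLC N f0 f1 f2 alpha 0 (0, u2eq)).
Proof.
move=> B1 B2 R1; rewrite -/R1 -/B1 in B1_notin.
have [A [Q [C [rho [rho0 C0 J0 J1 J2]]]]] := common_jets f0_analytic f1_analytic f2_analytic.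
have [U RU] : exists U : {vspace 'rV[R]_n}, forall v, R1 v <-> v \in U.
  exact: lin_span_vspace.
have [P [P0 PU]] := vspace_projector U.
have bP : f1 0 *m P = 0.
  apply/P0/RU; exists [:: f1 0]; last by rewrite memv_span// mem_head.
  by move=> x; rewrite inE => /eqP ->; exists 1%N, f1; split => //; exact: iterated_f1.
have stable g A' Q' : has_jet g 0 A' Q' C rho -> g 0 = 0 ->
    iterated_bracket f0 f1 f2 0 g ->
    forall x : 'rV[R]_n, x *m P *m A' *m P = x *m A' *m P.
  move=> J g0 gbr x; apply/eqP; rewrite eq_sym -subr_eq0 -!mulmxBl; apply/eqP/P0.
  exact: (R1_at0_mulmx rho0 C0 J g0 gbr RU) (PU x).
have PA0 := stable _ _ _ J0 f00 (iterated_f0 f0 f1 f2).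
have PA2 := stable _ _ _ J2 f20 (iterated_f2 f0 f1 f2).
have B1E : B1 0 = bracket2 (A 1) (f1 0) (A 0) (Q 0).
  exact: second_bracket_at0 J0 J1 f00.
have B2E : B2 0 = bracket2 (A 1) (f1 0) (A 2) (Q 2).
  exact: second_bracket_at0 J2 J1 f20.
have obstructed k (alpha u2eq : R) := not_alpha_STLC normN f0_analytic f1_analytic
  f2_analytic rho0 C0 J0 J1 J2 f00 f20 f10 (k := k) (alpha := alpha) (u2eq := u2eq) bP PA0 PA2.
rewrite -B1E -B2E in obstructed.
move: (B1 0) (B2 0) B1_notin obstructed => c1 c2 {B1E B2E} c1R obstructed.
have lamE v (k : 'cV[R]_n) : ((c1 + v *: c2) *m P *m k) 0 0 =
    (c1 *m P *m k) 0 0 + v * (c2 *m P *m k) 0 0.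
  by rewrite !mulmxDl -!scalemxAl !rvE.
have c1P : c1 *m P <> 0 by move=> /P0/RU.
(* By continuity a form not vanishing at u2eq keeps its sign for the admissible
   values of the second control, which may be far from u2eq only if the form
   vanishes on the second bracket. *)
have no_STLC (k : 'cV[R]_n) (alpha u2eq : R) : 0 <= alpha ->
    ((c1 + u2eq *: c2) *m P *m k) 0 0 != 0 -> (c2 *m P *m k) 0 0 * alpha = 0 ->
    ~ alpha_STLC N f0 f1 f2 alpha 0 (0, u2eq).
  move=> al0 gam0 cal.
  set gam := ((c1 + u2eq *: c2) *m P *m k) 0 0 in gam0 *.
  set c := (c2 *m P *m k) 0 0 in cal *.
  apply: (obstructed (Num.sg gam *: k)) => // K K0.
  have gpos : 0 < `|gam| by rewrite normr_gt0.
  have D0 : 0 < 2 * (`|c| * K + 1) by rewrite mulr_gt0// ltr_wpDl// mulr_ge0.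
  exists (`|gam| / (2 * (`|c| * K + 1))), (`|gam| / 2); split.
  - by rewrite divr_gt0.
  - by rewrite divr_gt0.
  set e0 := `|gam| / (2 * _) => v hv.
  have e0E : `|c| * K * e0 <= `|gam| / 2.
    have h : e0 * (2 * (`|c| * K + 1)) = `|gam| by rewrite /e0 divfK// gt_eqF.
    have e00 : 0 <= e0 by rewrite /e0 divr_ge0// ltW.
    by move: h; lra.
  rewrite -scalemxAr rvE.
  have -> : ((c1 + v *: c2) *m P *m k) 0 0 = gam + c * (v - u2eq).
    by rewrite /gam /c !lamE; ring.
  rewrite mulrDr -normrEsg.
  have : `|Num.sg gam * (c * (v - u2eq))| <= `|c| * K * e0.
    rewrite !normrM normr_sg gam0 mul1r -mulrA.
    apply: (@le_trans _ _ (`|c| * (K * (alpha + e0)))); first by rewrite ler_wpM2l.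
    have calN : `|c| * alpha = 0 by rewrite -[alpha]ger0_norm// -normrM cal normr0.
    have -> : `|c| * (K * (alpha + e0)) = K * (`|c| * alpha) + `|c| * (K * e0) by ring.
    by rewrite calN mulr0 add0r.
  by rewrite ler_norml => /andP[h1 _]; lra.
split.
- move=> _ beta /RU/P0 Rbeta u2eq ub.
  have [j c1j] : exists j, (c1 *m P) 0 j != 0.
    apply: contrapT => /forallNP h; apply: c1P; apply/rowP => i; rewrite rvE.
    by apply/eqP/negPn/negP/h.
  have betaE : (c1 *m P) 0 j + beta * (c2 *m P) 0 j = 0.
    by rewrite -rowZ -rowD scalemxAl -mulmxDl Rbeta rvE.
  apply: (no_STLC (delta_mx j 0)); rewrite ?mulr0//.
  rewrite lamE -!colE ![col _ _ _ _]mxE.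
  have -> : (c1 *m P) 0 j + u2eq * (c2 *m P) 0 j = (u2eq - beta) * (c2 *m P) 0 j.
    by move: betaE; lra.
  rewrite mulf_neq0// ?subr_eq0; first exact/eqP.
  by apply: contraNneq c1j => c2j; rewrite c2j mulr0 addr0 in betaE; rewrite betaE.
move=> notin u2eq alpha al0.
have nsub : ~~ (c1 *m P <= c2 *m P)%MS.
  apply/negP => /submxP[D DE]; apply: notin.
  exists (c1 - D 0 0 *: c2).
    apply/RU/P0; rewrite mulmxBl DE -scalemxAl [D]mx11_scalar mul_scalar_mx.
    by rewrite mxE eqxx mulr1n subrr.
  exists (D 0 0 *: c2); last by rewrite subrK.
  by exists [:: c2]; [move=> x; rewrite inE => /eqP | rewrite memvZ// memv_span// mem_head].
have [j kj] : exists j, (c1 *m P *m cokermx (c2 *m P)) 0 j != 0.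
  apply: contrapT => /forallNP h; move/negP: nsub; apply; rewrite submxE.
  by apply/eqP/rowP => i; rewrite rvE; apply/eqP/negPn/negP/h.
have c2k : (c2 *m P *m col j (cokermx (c2 *m P))) 0 0 = 0.
  by rewrite colE mulmxA mulmx_coker mul0mx rvE.
apply: (no_STLC (col j (cokermx (c2 *m P)))) => //; last by rewrite c2k mul0r.
by rewrite lamE c2k mulr0 addr0 colE mulmxA -colE mxE.
Qed.
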